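(* For $u\ge0$ and $p\in\mathbb{R}$ let $g_{p,u}(x):=\frac{e^{-px}}{x}-\frac{e^{-ux}}{e^x-1}$ for $x>0$, $g_{p,u}(0):=u+\frac12-p$; and let $h_u(x):=\frac{e^{-ux}x}{e^x-1}$ for $x>0$, $h_u(0):=1$. Then for every fixed $u\ge0$: (1) $g_{p,u}\in\Phi(l_2)$ if and only if $0\le p\le\sqrt{m_\infty(u)}$. (2) $-g_{p,u}\in\Phi(l_2)$ if and only if $p\ge\sqrt{M_\infty(u)}=u+1$. (3) The inequality $\frac{d}{dt}\left\{t^{2\mu}S_\mu(t,u)\right\}\ge0$ holds for every $\mu>0$ and $t>0$ if and only if $-\frac{d}{dx}(h_u(x))\in\Phi(l_2)$.
   Context: For $\mu>0$, $t\in\mathbb{R}$, $u\ge0$: $S_{\mu}(t,u):=\sum_{k=1}^{\infty}\frac{2(k+u)}{((k+u)^2+t^2)^{\mu+1}}$. Put $f_{\mu,u}(t)=(\mu S_\mu(t,u))^{-1/\mu}-t^2$, $m_\mu(u)=\inf_{t\ge0}f_{\mu,u}(t)$, $M_\mu(u)=\sup_{t\ge0}f_{\mu,u}(t)$, and $m_\infty(u):=\inf_{\mu>0}m_\mu(u)=\lim_{\mu\to+\infty}m_\mu(u)$, $M_\infty(u):=\sup_{\mu>0}M_\mu(u)=\lim_{\mu\to+\infty}M_\mu(u)$. A function $f:\mathbb{R}^m\to\mathbb{C}$ is positive definite if $\sum_{k,j=1}^n c_k\bar c_jf(x_k-x_j)\ge0$ for all $n\in\mathbb{N}$, $x_1,\dots,x_n\in\mathbb{R}^m$,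 $c_1,\dots,c_n\in\mathbb{C}$. $\Phi(l_2^m)$ is the class of continuous $f:[0,+\infty)\to\mathbb{R}$ such that $x\mapsto f(\|x\|_2)$ is positive definite on $\mathbb{R}^m$ ($\|\cdot\|_2$ the Euclidean norm), and $\Phi(l_2):=\bigcap_{m=1}^\infty\Phi(l_2^m)$. (By Schoenberg's theorem, $\Phi(l_2)$ consists of the functions $f(t)=\int_0^{+\infty}e^{-t^2s}\,d\mu(s)$ with $\mu$ a finite nonnegative Borel measure on $[0,+\infty)$.) The derivative $\frac{d}{dx}h_u$ is considered on $[0,+\infty)$, one-sided at $0$. *)

(* Defs.v *)
From mathcomp Require Import all_boot all_order all_algebra.
From mathcomp Require Import complex.
From mathcomp Require Import all_classical all_reals all_analysis.

Set Implicit Arguments.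
Unset Strict Implicit.
Unset Printing Implicit Defensive.

Import Order.TTheory GRing.Theory Num.Theory.
Import numFieldNormedType.Exports.

Local Open Scope classical_set_scope.
Local Open Scope ring_scope.

(* The series starts at k = 1, hence the k.+1 in the general term. *)
Definition S_mu {R : realType} (mu t u : R) : R :=
  limn (series (fun k : nat =>
    2 * (k.+1%:R + u) / ((k.+1%:R + u) ^+ 2 + t ^+ 2) `^ (mu + 1))).

Definition f_mu {R : realType} (mu u t : R) : R :=
  (mu * S_mu mu t u) `^ (- mu^-1) - t ^+ 2.

Definition m_mu {R : realType} (mu u : R) : \bar R :=
  ereal_inf [set (f_mu mu u t)%:E | t in [set t : R | 0 <= t]].

Definition M_mu {R : realType} (mu u : R) : \bar R :=
  ereal_sup [set (f_mu mu u t)%:E | t in [set t : R | 0 <= t]].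

Definition m_infty {R : realType} (u : R) : \bar R :=
  ereal_inf [set m_mu mu u | mu in [set mu : R | 0 < mu]].

Definition M_infty {R : realType} (u : R) : \bar R :=
  ereal_sup [set M_mu mu u | mu in [set mu : R | 0 < mu]].

(* The library's norm on 'rV[R]_d is the sup norm, so the Euclidean one is
   written out. *)
Definition norm2 {R : realType} (d : nat) (x : 'rV[R]_d) : R :=
  Num.sqrt (\sum_(i < d) x ord0 i ^+ 2).

(* In the order of R[i], 0 <= z means that z is real and nonnegative. *)
Definition positive_definite {R : realType} (d : nat)
    (F : 'rV[R]_d -> R[i]) : Prop :=
  forall (n : nat) (x : 'I_n -> 'rV[R]_d) (c : 'I_n -> R[i]),
    0 <= \sum_(k < n) \sum_(j < n) c k * (c j)^* * F (x k - x j).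

(* A function on [0, +oo) is represented by a total function phi : R -> R, of
   which only the values on [0, +oo) matter. *)
Definition Phi_dim {R : realType} (d : nat) (phi : R -> R) : Prop :=
  {within `[0, +oo[, continuous phi} /\
  positive_definite (fun x : 'rV[R]_d => (phi (norm2 x))%:C%C).

Definition Phi {R : realType} (phi : R -> R) : Prop :=
  forall d : nat, (0 < d)%N -> Phi_dim d phi.

Definition g {R : realType} (p u x : R) : R :=
  if 0 < x then expR (- p * x) / x - expR (- u * x) / (expR x - 1)
  else u + 2^-1 - p.

Definition h {R : realType} (u x : R) : R :=
  if 0 < x then expR (- u * x) * x / (expR x - 1) else 1.

(* Derivative of a function on [0, +oo): one-sided at 0. *)
Definition derive_halfline {R : realType} (phi : R -> R) (x : R) : R :=
  if 0 < x then derive1 phi x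
  else lim ((e^-1 * (phi e - phi 0)) @[e --> 0^'+]).

(* Main.v *)
Require Import Defs.
From mathcomp Require Import all_boot all_order all_algebra.
From mathcomp Require Import complex.
From mathcomp Require Import all_classical all_reals all_analysis.
From mathcomp Require Import measurable_realfun.
From mathcomp Require Import ring lra.

Import Order.TTheory GRing.Theory Num.Theory.
Import numFieldNormedType.Exports.

Local Open Scope classical_set_scope.
Local Open Scope ring_scope.

(** Write a_k = k + u for k >= 1.  The three claims are statements about the
    single function

      theta(s) = sum_k 2 a_k s exp(- a_k^2 s),   s > 0,

    namely theta(s) <= exp(- p^2 s) for (1), theta(s) >= exp(- p^2 s) for (2),
    and theta nonincreasing for (3).  Two transforms lead from theta to the two
    sides of the theorem.

    Subordination.  For x > 0 and a >= 0,

      exp(- a x) / x = (1/C) int_0^oo exp(- x^2 / (4 r^2)) exp(- a^2 r^2) dr / r^2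

    with C independent of a and x, and exp(- a x) is obtained by inserting the
    factor 2 a r^2 (heat_ker_integrals).  As exp(- u x) / (exp x - 1) is the sum
    of the exp(- a_k x), the function g_{p,u} is represented in this way by the
    weight exp(- p^2 r^2) - theta(r^2), and (h_u(q x) - h_u(x)) / x by the weight
    theta(q^2 r^2) - theta(r^2).  A continuous function represented by a weight w
    is in Phi(l_2) if and only if w >= 0.  If w >= 0 it is a mixture of Gaussians,
    which are positive definite (gauss_psd, heat_rep_radial_pd).  Conversely,
    positive definiteness in all dimensions makes the alternating differences of
    t |-> phi(sqrt t) nonnegative (radial_pd_completely_monotone), and these
    differences integrate w against powers of y (1 - y), y = exp(- h / (4 r^2)),
    which concentrate at the point where y = 1/2; that point is arbitrary, since
    h is (heat_rep_ge0).  For (3), - h_u' is a limit of the quotients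
    (h_u(q x) - h_u(x)) / ((1 - q) x) as q increases to 1, and these quotients are
    averages of - h_u'(rho x) over rho in [q, 1], so that - h_u' is in Phi(l_2)
    exactly when all of them are (Phi_derive_hP).

    Mellin transform.  For mu, q > 0 and c >= 0,

      int_0^oo s^(mu-1) exp(- c s) theta(q s) ds = G q^(-mu) S_mu(sqrt(c / q), u)

    with G = Gamma(mu + 1) (theta_gamma).  So each of the three properties of
    theta implies the corresponding one of the S_mu.  In the other direction
    mu (mu/s)^mu S_mu(sqrt(mu/s), u) tends to theta(s) as mu tends to infinity,
    by the exponential limit (1 + y/mu)^(-mu-1) -> exp(- y) in each term
    (limit_theta).  Thus p^2 <= m_oo(u) means theta(s) <= exp(- p^2 s)
    (le_sqrt_m_infty), and monotonicity of all t^(2 mu) S_mu(t, u) means that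
    theta is nonincreasing (derive_S_ge0P).

    The constants come from comparing the sum theta(s) with the integral of
    s exp(- s y) dy over the intervals cut out by the squares.  The trapezoidal
    rule gives theta(s) >= exp(- (u+1)^2 s) (theta_ge), the midpoint rule gives
    theta(s) <= 1 (theta_le1), hence m_oo(u) >= 0; and theta(s) exp((u+1)^2 s)
    grows at most linearly (theta_decay), so no smaller exponent works and
    M_oo(u) = (u+1)^2. *)

(** * Improper integrals from primitives *)

Section FTC.
Context {R : realType}.
Notation mu := (@lebesgue_measure R).

(** The integrands below may blow up at 0 and live on a half-line, so both
    boundary values of the primitive are limits; the open interval is exhausted
    by the half-lines [1/(n+1), +oo[. *)
Lemma ge0_FTC_0y (f F : R -> R) (l0 l1 : R) :
  (forall x : R, 0 < x -> 0 <= f x) ->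
  (forall x : R, 0 < x -> {for x, continuous f}) ->
  (forall x : R, 0 < x -> is_derive x 1 F (f x)) ->
  F x @[x --> 0^'+] --> l0 -> F x @[x --> +oo] --> l1 ->
  (\int[mu]_(x in `](0%R:R), +oo[) (f x)%:E = (l1 - l0)%:E)%E.
Proof.
move=> f0 cf dF F0 F1.
have cF x : 0 < x -> {for x, continuous F}.
  move=> x0; apply: differentiable_continuous.
  by apply/derivable1_diffP; apply: ex_derive; exact: dF.
pose A (n : nat) : set R := `[n.+1%:R^-1, +oo[%classic.
have n0 (n : nat) : 0 < (n.+1%:R^-1 : R) by rewrite invr_gt0.
have mfo : measurable_fun `](0:R), +oo[ f.
  apply: open_continuous_measurable_fun => // x.
  by rewrite inE/= in_itv/= andbT; exact: cf.
have AU : \bigcup_n A n = `](0:R), +oo[%classic.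
  apply/seteqP; split => x/=.
    by case=> n _; rewrite /A/= !in_itv/= !andbT; apply: lt_le_trans.
  rewrite in_itv/= andbT => x0.
  have [n nx] : exists n : nat, n.+1%:R^-1 < x.
    have := near_infty_natSinv_lt (PosNum x0).
    by move=> [N _ /(_ N (leqnn _)) NN]; exists N.
  by exists n => //; rewrite /A/= in_itv/= andbT ltW.
have subA n : A n `<=` `](0:R), +oo[%classic.
  by move=> x; rewrite /A/= !in_itv/= !andbT; exact: lt_le_trans.
have AE n : (\int[mu]_(x in A n) (f x)%:E = (l1 - F n.+1%:R^-1)%:E)%E.
  rewrite EFinB; apply: ge0_continuous_FTC2y => //.
  - by move=> x nx; apply: f0; exact: lt_le_trans nx.
  - apply: continuous_in_subspaceT => x; rewrite inE => /subA /=.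
    by rewrite in_itv/= andbT; exact: cf.
  - by move=> x nx; apply: ex_derive; apply: dF; exact: lt_trans nx.
  - by apply: cvg_at_right_filter; exact: cF.
  - move=> x; rewrite in_itv/= andbT => nx.
    have := dF x (lt_trans (n0 n) nx) => -[_].
    by rewrite derive1E.
rewrite -AU.
have C : (\int[mu]_(x in A i) (f x)%:E)%E @[i --> \oo] -->
    (\int[mu]_(x in \bigcup_i A i) (f x)%:E)%E.
  apply: (@ge0_nondecreasing_set_cvg_integral _ (measurableTypeR R) R A (EFin \o
    f) (@lebesgue_measure R)).
  - apply/nondecreasing_seqP => n; rewrite subsetEset => x.
    rewrite /A/= !in_itv/= !andbT; apply: le_trans.
    by rewrite lef_pV2 ?posrE// ler_nat.
  - by move=> n; apply: measurable_itv.
  - by move=> n; apply/measurable_EFinP; apply: measurable_funS mfo.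
  - move=> n x Ax; rewrite lee_fin; apply: f0.
    by move: (subA _ _ Ax); rewrite /= in_itv/= andbT.
move/cvg_lim : C => <-//.
apply/cvg_lim => //.
rewrite (_ : (fun i : nat => _) = EFin \o (fun n : nat => l1 - F n.+1%:R^-1));
  last first.
  by apply/funext => n /=; rewrite -AE.
apply: cvg_EFin; first exact: nearW.
apply: cvgB; first exact: cvg_cst.
by move/cvg_at_rightP : F0; apply; split => //; exact: cvg_harmonic.
Qed.

End FTC.

Section Primitives.
Context {R : realType}.
Notation mu := (@lebesgue_measure R).

Lemma is_derive_continuous (f : R -> R) (x df : R) :
  is_derive x 1 f df -> {for x, continuous f}.
Proof.
by move=> H; apply: differentiable_continuous; apply/derivable1_diffP;
  apply: ex_derive.
Qed.

Lemma ge0_derive_le (f df : R -> R) (a b : R) : a <= b ->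
  (forall x : R, a <= x <= b -> is_derive x 1 f (df x)) ->
  (forall x : R, a <= x <= b -> 0 <= df x) -> f a <= f b.
Proof.
move=> ab Hd d0.
have [|//|c] := @MVT_segment R f df a b ab.
- by move=> x; rewrite in_itv/= => /andP[/ltW h1 /ltW h2]; apply: Hd; rewrite h1.
- apply: derivable_within_continuous => x; rewrite in_itv/= => h.
  by apply: ex_derive; exact: Hd.
- rewrite in_itv/= => h E; rewrite -subr_ge0 E mulr_ge0 ?subr_ge0//.
  exact: d0.
Qed.

Lemma Rintegral_prefix_homo (f : R -> R) (b : itv_bound R) :
  (forall x : R, 0 <= f x) ->
  (forall y : R, mu.-integrable [set` Interval b (BRight y)] (EFin \o f)) ->
  {homo (fun y : R => (\int[mu]_(t in [set` Interval b (BRight y)]) (f t))%R) : x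
    y / x <= y}.
Proof.
move=> f0 fi x y xy /=; rewrite /Rintegral fine_le//.
- exact: integrable_fin_num (fi x).
- exact: integrable_fin_num (fi y).
- apply: ge0_subset_integral => //.
  + by have /integrableP[] := fi y.
  + by move=> z _; rewrite lee_fin.
  + by apply: subset_itvl; rewrite bnd_simp.
Qed.

(** The difference of the two limits is the constant C of
    heat_ker_integrals. *)
Lemma gauss_primitive : exists E : R -> R, exists l0 l1 : R,
  [/\ l0 < l1, forall x : R, is_derive x 1 E (expR (- x ^+ 2)),
      E x @[x --> -oo] --> l0 & E x @[x --> +oo] --> l1].
Proof.
pose E (x : R) := (\int[mu]_(t in [set` `]-oo, x]]) (gauss_fun t))%R.
have Ei (y : R) : mu.-integrable `]-oo, y] (EFin \o @gauss_fun R).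
  by apply: integrableS integrableT_gauss.
have dE (x : R) : is_derive x 1 E (expR (- x ^+ 2)).
  have x1 : x < x + 1 by rewrite ltrDl.
  have [||h1 h2] := @continuous_FTC1 R (@gauss_fun R) -oo%O x (x + 1) x1 (Ei _).
  - by rewrite ltNyr.
  - exact: continuous_gauss_fun.
  - by split; [exact: h1|rewrite -derive1E; exact: h2].
have hE : {homo E : x y / x <= y}.
  by apply: Rintegral_prefix_homo => // x; exact: gauss_fun_ge0.
have E0 x : 0 <= E x by apply: Rintegral_ge0 => // t _; exact: gauss_fun_ge0.
have EM x : E x <= Num.sqrt pi.
  rewrite /E /Rintegral -[leRHS]/(fine (Num.sqrt pi)%:E) -integralT_gauss fine_le//.
  - exact: integrable_fin_num (Ei x).
  - by rewrite integralT_gauss.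
  - apply: ge0_subset_integral => //.
    + by have /integrableP[] := @integrableT_gauss R.
    + by move=> z _; rewrite lee_fin gauss_fun_ge0.
have c1 : E x @[x --> +oo] --> sup (range E).
  by apply: nondecreasing_cvgr => //; exists (Num.sqrt pi) => _ [x _ <-].
have c0 : E x @[x --> -oo] --> - sup (range (fun x => - E (- x))).
  apply/cvgNy_compNP => /=.
  rewrite -[X in X @ _](_ : (fun x => - (- E (- x))) = _); last first.
    by apply/funext => x; rewrite /= opprK.
  apply: cvgN; apply: nondecreasing_cvgr.
    by move=> x y xy; rewrite lerN2; apply: hE; rewrite lerN2.
  by exists 0 => _ [x _ <-]; rewrite oppr_le0.
exists E, (- sup (range (fun x => - E (- x)))), (sup (range E)); split => //.
have lo : - sup (range (fun x => - E (- x))) <= E 0.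
  apply: (cvgr_to_le c0).
  by exists 0; split => // x x0; apply: hE; exact: ltW.
have hi : E 1 <= sup (range E).
  apply: (cvgr_to_ge c1).
  by exists 1; split => // x x0; apply: hE; exact: ltW.
apply: (le_lt_trans lo); apply: (lt_le_trans _ hi).
have [|x x01 e] := @MVT R E (fun x => expR (- x ^+ 2)) 0 1 ltr01 (fun x _ => dE x).
  by apply: derivable_within_continuous => x _; apply: ex_derive.
by rewrite -subr_gt0 e mulr_gt0 ?expR_gt0// subr0.
Qed.

(** This is ln y < y at y = v / (2 m); it dominates the integrand of the
    Gamma function by a decaying exponential. *)
Lemma powR_expR_le (m v : R) : 0 < m -> 0 < v ->
  v `^ m * expR (- v) <= (2 * m) `^ m * expR (- (v / 2)).
Proof.
move=> m0 v0; rewrite /powR !gt_eqF ?mulr_gt0// -!expRD ler_expR.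
have := ln_sublinear (_ : 0 < v / (2 * m)).
rewrite divr_gt0 ?mulr_gt0// => /(_ isT).
rewrite ln_div ?posrE ?mulr_gt0// => /ltW.
rewrite -(ler_pM2l m0) => h.
have e : m * (v / (2 * m)) = v / 2 by field; rewrite gt_eqF.
by move: h; rewrite e mulrBr; lra.
Qed.

(** A primitive of the integrand of Gamma(m + 1).  It is bounded because
    adding 2 (2 m)^m exp(- x / 2) to it gives a nonincreasing function, by
    powR_expR_le. *)
Lemma gamma_primitive (m : R) : 0 < m -> exists P : R -> R, exists l0 l1 : R,
  [/\ l0 < l1, forall x : R, 0 < x -> is_derive x 1 P (x `^ m * expR (- x)),
      P x @[x --> 0^'+] --> l0 & P x @[x --> +oo] --> l1].
Proof.
move=> m0; pose f (x : R) := x `^ m * expR (- x).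
pose P (x : R) := (\int[mu]_(t in [set` `[0, x]]) (f t))%R.
have f0 x : 0 <= f x by rewrite mulr_ge0 ?powR_ge0 ?expR_ge0.
have mf : measurable_fun setT f.
  apply: measurable_funM; first exact: measurable_powR.
  by apply: measurableT_comp => //; exact: measurable_expR.
have fi (y : R) : mu.-integrable `[0, y] (EFin \o f).
  apply: measurable_bounded_integrable => //.
  - by rewrite /= lebesgue_measure_itv/=; case: ifP => // _; rewrite -EFinB ltry.
  - exact: measurable_funTS.
  - exists ((2 * m) `^ m); split; first exact: num_real.
    move=> M hM x /=; rewrite in_itv/= => /andP[x0 _].
    rewrite ger0_norm//; apply: le_trans (ltW hM).
    move: x0; rewrite le_eqVlt => /predU1P[<-|x0].
      by rewrite /f powR0 ?gt_eqF// mul0r powR_ge0.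
    apply: le_trans (powR_expR_le _ _ m0 x0) _.
    rewrite ler_piMr ?powR_ge0// -expR0 ler_expR oppr_le0.
    by rewrite divr_ge0// ltW.
have dP (x : R) : 0 < x -> is_derive x 1 P (f x).
  move=> x0; have x1 : x < x + 1 by rewrite ltrDl.
  have [||h1 h2] := @continuous_FTC1_closed R f 0 x (x + 1) x1 (fi _).
  - by [].
  - apply: cvgM; first exact: is_derive_continuous (is_derive1_powR _ x0).
    apply: continuous_comp; first exact: opp_continuous.
    exact: continuous_expR.
  - by split; [exact: h1|rewrite -derive1E; exact: h2].
have hP : {homo P : x y / x <= y} by exact: Rintegral_prefix_homo.
have P0 x : 0 <= P x by exact: Rintegral_ge0.
pose M := (2 * m) `^ m.
have PM x : P x <= P 1 + M * 2 * expR (- (1 / 2)).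
  have M0 : 0 <= M by exact: powR_ge0.
  have [x1|x1] := leP x 1.
    by apply: le_trans (hP _ _ x1) _; rewrite lerDl !mulr_ge0 ?expR_ge0.
  have -> : M * 2 * expR (- (1 / 2)) = M * 2 * expR (- (x / 2)) + (M * 2 * expR
    (- (1 / 2)) - M * 2 * expR (- (x / 2))) by lra.
  suff : P x + M * 2 * expR (- (x / 2)) <= P 1 + M * 2 * expR (- (1 / 2)).
    move=> h; have : 0 <= M * 2 * expR (- (x / 2)) by rewrite !mulr_ge0 ?expR_ge0.
    by move: h; lra.
  rewrite -lerN2.
  apply: (@ge0_derive_le (fun x => - (P x + M * 2 * expR (- (x / 2))))
    (fun x => M * expR (- (x / 2)) - f x)); first exact: ltW.
  - move=> y /andP[y1 _].
    have y0 : 0 < y by lra.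
    have := dP _ y0 => dPy.
    apply: is_derive_eq; rewrite /= /GRing.scale/=. by field.
  - move=> y /andP[y1 _]; rewrite subr_ge0; apply: powR_expR_le => //; lra.
have c1 : P x @[x --> +oo] --> sup (range P).
  by apply: nondecreasing_cvgr => //; eexists => _ [x _ <-]; exact: PM.
have /cvg_ex[l0 c0] : cvg (P x @[x --> 0^'+]).
  apply: nondecreasing_at_right_is_cvgr.
  - by near=> y => x z _ _ xz; exact: hP.
  - by near=> y; exists 0 => _ [x _ <-].
exists P, l0, (sup (range P)); split => //.
have lo : l0 <= P 1.
  apply: (cvgr_to_le c0).
  by near=> x; apply: hP; near: x; exact: nbhs_right_le.
have hi : P 2 <= sup (range P).
  apply: (cvgr_to_ge c1).
  by exists 2; split => // x x0; apply: hP; exact: ltW.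
apply: (le_lt_trans lo); apply: (lt_le_trans _ hi).
have [| | |x x01 e] := @MVT R P f 1 2.
- by lra.
- by move=> x; rewrite in_itv/= => /andP[x1 _]; apply: dP; lra.
- apply: derivable_within_continuous => x; rewrite in_itv/= => /andP[x1 _].
  by apply: ex_derive; apply: dP; lra.
rewrite -subr_gt0 e; apply: mulr_gt0; last lra.
move: x01; rewrite in_itv/= => /andP[x1 _].
by rewrite mulr_gt0 ?expR_gt0// powR_gt0; lra.
Unshelve. all: by end_near. Qed.

End Primitives.

(** * The subordination integrals *)

Section Kernel.
Context {R : realType}.
Notation mu := (@lebesgue_measure R).

(** In the variable tau = 1 / (4 r^2) this is exp(- tau x^2): integrating
    heat_ker x r against a weight in r is taking a mixture of Gaussians in x. *)
Definition heat_ker (x r : R) : R := expR (- (x ^+ 2 / (4 * r ^+ 2))) / r ^+ 2.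

Lemma is_derive_hyperb (a b r : R) : 0 < r ->
  is_derive r 1 (fun r => a * r + b / (2 * r)) (a - b / (2 * r ^+ 2)).
Proof.
move=> r0; have r0' : r != 0 by rewrite gt_eqF.
rewrite (_ : (fun r => _) = (fun r => a * r + (b / 2) * r^-1)); last first.
  by apply/funext => z; rewrite invfM mulrA.
have := @is_deriveV R (@id R) r 1 1 r0' _ => dV.
by apply: is_derive_eq; rewrite /= /GRing.scale/=; field.
Qed.

Lemma hyperb_cvg0y (a x : R) : 0 <= a -> 0 < x ->
  a * r + x / (2 * r) @[r --> 0^'+] --> +oo.
Proof.
move=> a0 x0; apply/cvgryPge => A;
  have A0 : 0 < 2 * (`|A| + 1) by rewrite mulr_gt0// ltr_wpDl.
near=> r.
have r0 : 0 < r by near: r; exact: nbhs_right_gt.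
have rA : r <= x / (2 * (`|A| + 1)).
  by near: r; apply: nbhs_right_le; apply: divr_gt0.
apply: (@le_trans _ _ (x / (2 * r))); last by rewrite lerDr mulr_ge0// ltW.
rewrite ler_pdivlMr ?mulr_gt0//; move: rA; rewrite ler_pdivlMr//.
have := ler_norm A; have : 0 <= `|A| by []; nra.
Unshelve. all: by end_near. Qed.

Lemma hyperb_cvg0Ny (a x : R) : 0 <= a -> 0 < x ->
  a * r - x / (2 * r) @[r --> 0^'+] --> -oo.
Proof.
move=> a0 x0; apply/cvgrNyPle => A;
  have A0 : 0 < 2 * (`|A| + a + 1) by rewrite mulr_gt0// ltr_wpDl// addr_ge0.
near=> r.
have r0 : 0 < r by near: r; exact: nbhs_right_gt.
have rA : r <= x / (2 * (`|A| + a + 1)).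
  by near: r; apply: nbhs_right_le; apply: divr_gt0.
have r1 : r <= 1 by near: r; apply: nbhs_right_le.
have h : `|A| + a + 1 <= x / (2 * r).
  rewrite ler_pdivlMr ?mulr_gt0//; move: rA; rewrite ler_pdivlMr//.
  by lra.
have h2 : a * r <= a by rewrite ler_piMr.
have := ler_norm (- A); rewrite normrN; lra.
Unshelve. all: by end_near. Qed.

Lemma hyperb_cvgyy (a b : R) : 0 < a ->
  a * r + b / (2 * r) @[r --> +oo] --> +oo.
Proof.
move=> a0; apply/cvgryPge => A; near=> r.
have r1 : 1 <= r by near: r; apply: nbhs_pinfty_ge; rewrite num_real.
have rA : (A + `|b|) / a <= r by near: r; apply: nbhs_pinfty_ge; rewrite num_real.
have r0 : 0 < 2 * r by lra.
have h : - `|b| <= b / (2 * r).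
  rewrite lerNl -mulNr ler_pdivrMr//.
  have := ler_norm (- b); rewrite normrN; have : 0 <= `|b| by []; nra.
move: rA; rewrite ler_pdivrMr//; lra.
Unshelve. all: by end_near. Qed.

Lemma inv_cvgy0 (b : R) : b / (2 * r) @[r --> +oo] --> 0.
Proof.
apply/cvgrPdist_le => e e0; near=> r.
have r1 : 1 <= r by near: r; apply: nbhs_pinfty_ge; rewrite num_real.
have r0 : 0 < 2 * r by lra.
have rA : `|b| / e <= r by near: r; apply: nbhs_pinfty_ge; rewrite num_real.
rewrite sub0r normrN normrM normfV (gtr0_norm r0) ler_pdivrMr//.
move: rA; rewrite ler_pdivrMr//; nra.
Unshelve. all: by end_near. Qed.

(** The exponents differ by completing the square in a r and x / (2 r); the
    cross term is a x, which does not depend on r. *)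
Lemma square_completion (a x r : R) : 0 < r ->
  expR (- a * x) * expR (- (a * r - x / (2 * r)) ^+ 2) =
  expR (- (x ^+ 2 / (4 * r ^+ 2))) * expR (- (a ^+ 2 * r ^+ 2)).
Proof.
move=> r0; rewrite -!expRD; congr expR.
by field; rewrite gt_eqF.
Qed.

Lemma heat_ker_ge0 (x r : R) : 0 <= heat_ker x r.
Proof. by rewrite /heat_ker divr_ge0 ?expR_ge0 ?sqr_ge0. Qed.

Lemma heat_ker_continuous (x r : R) : 0 < r -> {for r, continuous (heat_ker x)}.
Proof.
move=> r0; have r0' : r != 0 by rewrite gt_eqF.
have cV : {for r, continuous (fun r : R => (r ^+ 2)^-1)}.
  by apply: cvgV; [rewrite sqrf_eq0|exact: exprn_continuous].
rewrite /heat_ker; apply: cvgM; last exact: cV.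
apply: continuous_comp; last exact: continuous_expR.
apply: cvgN; apply: cvgM; first exact: cvg_cst.
rewrite [X in X @ _](_ : _ = (fun r : R => 4^-1 * (r ^+ 2)^-1)); last first.
  by apply/funext => z; rewrite invfM.
by rewrite invfM; apply: cvgM; [exact: cvg_cst|exact: cV].
Qed.

Lemma expsq_continuous (a : R) : continuous (fun r : R =>
  expR (- (a ^+ 2 * r ^+ 2))).
Proof.
move=> r; apply: continuous_comp; last exact: continuous_expR.
by apply: cvgN; apply: cvgM; [exact: cvg_cst|exact: exprn_continuous].
Qed.

(** With E a primitive of exp(- z^2), the functions
    exp(- a x) E(a r - x/(2 r)) and exp(a x) E(a r + x/(2 r)) of r have derivatives
    (a + x/(2 r^2)) W and (a - x/(2 r^2)) W with the same factor
    W = exp(- x^2/(4 r^2) - a^2 r^2).  Their difference is a primitive of x W / r^2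
    and their sum one of 2 a W.  The constant C is the total variation of E. *)
Lemma heat_ker_integrals : exists2 C : R, 0 < C & forall x : R, 0 < x ->
  (forall a : R, 0 <= a ->
    (\int[mu]_(r in `](0%R:R), +oo[) (heat_ker x r * expR (- (a ^+ 2 * r ^+ 2)))%:E
     = (C * (expR (- a * x) / x))%:E)%E) /\
  (forall a : R, 0 < a ->
    (\int[mu]_(r in `](0%R:R), +oo[)
        (heat_ker x r * (2 * a * r ^+ 2 * expR (- (a ^+ 2 * r ^+ 2))))%:E
     = (C * expR (- a * x))%:E)%E).
Proof.
have [E [L0 [L1 [L01 dE EN EP]]]] := @gauss_primitive R.
exists (L1 - L0); first by rewrite subr_gt0.
move=> x x0.
have dEm (a r : R) : 0 < r -> is_derive r 1 (fun r => E (a * r - x / (2 * r)))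
    (expR (- (a * r - x / (2 * r)) ^+ 2) * (a + x / (2 * r ^+ 2))).
  move=> r0; have := @is_derive_hyperb a (- x) r r0.
  rewrite (_ : (fun r => _) = (fun r => a * r - x / (2 * r))); last first.
    by apply/funext => z; rewrite mulNr.
  rewrite mulNr opprK => d1.
  exact: (@is_derive1_comp _ E (fun r => a * r - x / (2 * r))).
have dEp (a r : R) : 0 < r -> is_derive r 1 (fun r => E (a * r + x / (2 * r)))
    (expR (- (a * r + x / (2 * r)) ^+ 2) * (a - x / (2 * r ^+ 2))).
  move=> r0; have := @is_derive_hyperb a x r r0 => d1.
  exact: (@is_derive1_comp _ E (fun r => a * r + x / (2 * r))).
have kp (a r : R) : 0 < r ->
  expR (a * x) * expR (- (a * r + x / (2 * r)) ^+ 2) =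
  expR (- (x ^+ 2 / (4 * r ^+ 2))) * expR (- (a ^+ 2 * r ^+ 2)).
  move=> r0; rewrite -(square_completion a x r r0) -!expRD; congr expR.
  by field; rewrite gt_eqF.
have z0 (a : R) : 0 <= a -> E (a * r - x / (2 * r)) @[r --> 0^'+] --> L0.
  by move=> a0; apply: cvg_comp EN; exact: hyperb_cvg0Ny.
have z1 (a : R) : 0 <= a -> E (a * r + x / (2 * r)) @[r --> 0^'+] --> L1.
  by move=> a0; apply: cvg_comp EP; exact: hyperb_cvg0y.
have y0 (a : R) : 0 < a -> E (a * r - x / (2 * r)) @[r --> +oo] --> L1.
  move=> a0; apply: cvg_comp EP.
  have := @hyperb_cvgyy a (- x) a0.
  by under eq_fun do rewrite mulNr.
have y1 (a : R) : 0 < a -> E (a * r + x / (2 * r)) @[r --> +oo] --> L1.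
  by move=> a0; apply: cvg_comp EP; exact: hyperb_cvgyy.
split => a a0.
- rewrite (_ : (L1 - L0) * _ = (expR (- a * x) * L1 - expR (a * x) * L1) / x -
     (expR (- a * x) * L0 - expR (a * x) * L1) / x); last first.
    by field; rewrite gt_eqF.
  apply: (@ge0_FTC_0y R (fun r => heat_ker x r * expR (- (a ^+ 2 * r ^+ 2)))
     (fun r => (expR (- a * x) * E (a * r - x / (2 * r)) -
       expR (a * x) * E (a * r + x / (2 * r))) / x)
     ((expR (- a * x) * L0 - expR (a * x) * L1) / x)
     ((expR (- a * x) * L1 - expR (a * x) * L1) / x)).
  + by move=> r r0; rewrite mulr_ge0 ?heat_ker_ge0 ?expR_ge0.
  + move=> r r0; apply: cvgM; first exact: heat_ker_continuous.
    exact: expsq_continuous.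
  + move=> r r0; have := dEm a r r0; have := dEp a r r0 => dp dm.
    apply: is_derive_eq; rewrite /= /GRing.scale/=.
    rewrite [expR (- a * x) * (expR _ * _)]mulrA [expR (a * x) * (expR _ * _)]mulrA.
    rewrite square_completion// kp// /heat_ker.
    by field; rewrite !gt_eqF.
  + apply: cvgM; last exact: cvg_cst.
    by apply: cvgB; apply: cvgM; [exact: cvg_cst|exact: z0|exact: cvg_cst|exact:
      z1].
  + apply: cvgM; last exact: cvg_cst.
    move: a0; rewrite le_eqVlt => /predU1P[<-|a0].
      have H : E (- (x / (2 * r))) - E (x / (2 * r)) @[r --> +oo] --> E 0 - E 0.
        apply: cvgB.
          apply: continuous_cvg; first exact: is_derive_continuous (dE 0).
          by rewrite -oppr0; apply: cvgN; exact: inv_cvgy0.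
        apply: continuous_cvg; first exact: is_derive_continuous (dE 0).
        exact: inv_cvgy0.
      rewrite oppr0 !mul0r expR0 subrr; rewrite subrr in H.
      rewrite (_ : (fun r => _) = fun r => E (- (x / (2 * r))) - E (x / (2 * r)))//.
      by apply/funext => r; rewrite !mul0r !add0r !mul1r.
    by apply: cvgB; apply: cvgM; [exact: cvg_cst|exact: y0|exact: cvg_cst|exact:
      y1].
- rewrite (_ : (L1 - L0) * _ = (expR (- a * x) * L1 + expR (a * x) * L1) -
     (expR (- a * x) * L0 + expR (a * x) * L1)); last by ring.
  apply: (@ge0_FTC_0y R
     (fun r => heat_ker x r * (2 * a * r ^+ 2 * expR (- (a ^+ 2 * r ^+ 2))))
     (fun r => expR (- a * x) * E (a * r - x / (2 * r)) +
       expR (a * x) * E (a * r + x / (2 * r)))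
     (expR (- a * x) * L0 + expR (a * x) * L1)
     (expR (- a * x) * L1 + expR (a * x) * L1)).
  + move=> r r0; rewrite mulr_ge0 ?heat_ker_ge0// mulr_ge0 ?expR_ge0//.
    by rewrite !mulr_ge0// ltW.
  + move=> r r0; apply: cvgM; first exact: heat_ker_continuous.
    apply: cvgM; last exact: expsq_continuous.
    by apply: cvgM; [exact: cvg_cst|exact: exprn_continuous].
  + move=> r r0; have := dEm a r r0; have := dEp a r r0 => dp dm.
    apply: is_derive_eq; rewrite /= /GRing.scale/=.
    rewrite [expR (- a * x) * (expR _ * _)]mulrA [expR (a * x) * (expR _ * _)]mulrA.
    rewrite square_completion// kp// /heat_ker.
    by field; rewrite !gt_eqF.
  + by apply: cvgD; apply: cvgM; [exact: cvg_cst|exact/z0/ltW|exact: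
      cvg_cst|exact/z1/ltW].
  + by apply: cvgD; apply: cvgM; [exact: cvg_cst|exact: y0|exact: cvg_cst|exact:
      y1].
Qed.

End Kernel.

(** * Dominated series *)

Section SeriesTools.
Context {R : realType}.

Lemma nnseries_cvg_bounded (f : nat -> R) (B : R) : (forall k, 0 <= f k) ->
  (forall n, series f n <= B) -> cvgn (series f).
Proof.
move=> f0 fB; apply: nondecreasing_is_cvgn.
  exact: nondecreasing_series.
by exists B => _ [n _ <-].
Qed.

Lemma nnseries_le_lim (f : nat -> R) n : (forall k, 0 <= f k) ->
  cvgn (series f) -> series f n <= limn (series f).
Proof.
by move=> f0 cf; apply: nondecreasing_cvgn_le => //; exact: nondecreasing_series.
Qed.

Lemma nnseries_lim_le (f : nat -> R) (B : R) : (forall k, 0 <= f k) ->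
  (forall n, series f n <= B) -> limn (series f) <= B.
Proof.
move=> f0 fB; apply: limr_le; first exact: nnseries_cvg_bounded fB.
by near=> n.
Unshelve. all: by end_near. Qed.

Lemma series_dominated_cvg (f M : nat -> R) : (forall k, `|f k| <= M k) ->
  cvgn (series M) -> cvgn (series f).
Proof.
move=> fM cM; apply: normed_cvg.
apply: (@series_le_cvg _ (fun k => `|f k|) M) => // n.
by apply: le_trans (fM n).
Qed.

Lemma series_tail_le (f M : nat -> R) N : (forall k, `|f k| <= M k) ->
  cvgn (series M) ->
  `|limn (series f) - series f N| <= limn (series M) - series M N.
Proof.
move=> fM cM; have cf := series_dominated_cvg _ _ fM cM.
have c1 : `|series f n - series f N| @[n --> \oo] --> `|limn (series f) - series
  f N|.
  by apply: cvg_norm; apply: cvgB; [exact: cf|exact: cvg_cst].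
have c2 : series M n - series M N @[n --> \oo] --> limn (series M) - series M N.
  by apply: cvgB; [exact: cM|exact: cvg_cst].
apply: (ler_cvg_to c1 c2); near=> n.
have Nn : (N <= n)%N by near: n; exists N.
rewrite !sub_series_geq//.
by apply: le_trans (ler_norm_sum _ _ _) _; exact: ler_sum.
Unshelve. all: by end_near. Qed.

(** Tannery's theorem: split at an index beyond which the dominating series
    is small, uniformly in t. *)
Lemma tannery (T : Type) (F : set_system T) {FF : ProperFilter F}
    (f : T -> nat -> R) (l M : nat -> R) :
  cvgn (series M) ->
  (forall k, f t k @[t --> F] --> l k) ->
  (\forall t \near F, forall k, `|f t k| <= M k) ->
  limn (series (f t)) @[t --> F] --> limn (series l).
Proof.
move=> cM fl fM.
have lM k : `|l k| <= M k.
  have h : `|f t k| @[t --> F] --> `|l k| by exact: cvg_norm (fl k).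
  by apply: (cvgr_to_le h); apply: filterS fM => t; exact.
apply/cvgrPdist_le => e e0.
have e3 : 0 < e / 3 by rewrite divr_gt0.
have [N _ HN] : \forall n \near \oo, `|limn (series M) - series M n| <= e / 3.
  by move/cvgrPdist_le : cM; apply.
have {}HN := HN N (leqnn _).
have sN : series (f t) N @[t --> F] --> series l N.
  elim: N {HN} => [|N IH].
    by rewrite /series/= big_geq//; under eq_fun do rewrite big_geq//;
      exact: cvg_cst.
  rewrite seriesSr/=; under eq_fun do rewrite seriesSr/=.
  by apply: cvgD; [exact: IH|exact: fl].
move/cvgrPdist_le : sN => /(_ _ e3) sN.
near=> t.
have ft : forall k, `|f t k| <= M k by near: t.
have st : `|series l N - series (f t) N| <= e / 3 by near: t.
have h1 := series_tail_le _ _ N lM cM.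
have h2 := series_tail_le _ _ N ft cM.
have h3 := le_trans (ler_norm _) HN.
rewrite (_ : _ - _ = (limn (series l) - series l N) + (series l N - series (f t) N)
  - (limn (series (f t)) - series (f t) N)); last by ring.
apply: le_trans (ler_normB _ _) _.
apply: le_trans (lerD (ler_normD _ _) (lexx _)) _.
by move: h1 h2 h3 st; lra.
Unshelve. all: by end_near. Qed.

Lemma series_cvgB (f g : nat -> R) : cvgn (series f) -> cvgn (series g) ->
  series (fun k => f k - g k) @ \oo --> limn (series f) - limn (series g).
Proof.
move=> cf cg.
rewrite (_ : series _ = fun n => series f n - series g n).
  exact: cvgB.
by apply/funext => n; rewrite /series/= sumrB.
Qed.

Lemma series_cvgZ (f : nat -> R) (c : R) : cvgn (series f) ->
  series (fun k => c * f k) @ \oo --> c * limn (series f).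
Proof.
move=> cf.
rewrite (_ : series _ = fun n => c * series f n).
  by apply: cvgM; [exact: cvg_cst|exact: cf].
by apply/funext => n; rewrite /series/= mulr_sumr.
Qed.

Lemma nneseries_limn (f : nat -> R) : (forall k, 0 <= f k) -> cvgn (series f) ->
  (\sum_(k <oo) (f k)%:E = (limn (series f))%:E)%E.
Proof.
move=> f0 cf; rewrite -EFin_lim//; congr (limn _).
by apply/funext => n; rewrite /= sumEFin.
Qed.

Lemma integral_series (D : set R) (f : nat -> R -> R) (I : nat -> R) :
  measurable D -> (forall k, measurable_fun D (f k)) ->
  (forall k (r : R), D r -> 0 <= f k r) ->
  (forall r : R, D r -> cvgn (series (f^~ r))) ->
  (forall k, \int[@lebesgue_measure R]_(r in D) (f k r)%:E = (I k)%:E)%E ->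
  cvgn (series I) ->
  (\int[@lebesgue_measure R]_(r in D) (limn (series (f^~ r)))%:E = (limn (series
    I))%:E)%E.
Proof.
move=> mD mf f0 cf fI cI.
have I0 k : 0 <= I k.
  by rewrite -lee_fin -fI; apply: integral_ge0 => r Dr; rewrite lee_fin f0.
rewrite -nneseries_limn//.
under [in RHS]eq_eseriesr do rewrite -fI.
rewrite -(@integral_nneseries _ (measurableTypeR R) R (@lebesgue_measure R) D mD
  (fun k r => (f k r)%:E)).
- apply: eq_integral => r; rewrite inE => Dr.
  by rewrite nneseries_limn//; [move=> k; exact: f0|exact: cf].
- by move=> k; apply/measurable_EFinP; exact: mf.
- by move=> k r Dr; rewrite lee_fin f0.
Qed.

End SeriesTools.

(** * The function theta *)

Section Theta.
Context {R : realType}.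
Variable u : R.
Hypothesis u0 : 0 <= u.

(** The points a_k of the series, numbered from k = 0. *)
Definition node (k : nat) : R := k.+1%:R + u.

Lemma node_ge1 k : 1 <= node k.
Proof. by rewrite /node -natr1 -addrA addrCA lerDl addr_ge0. Qed.

Lemma node_gt0 k : 0 < node k.
Proof. exact: lt_le_trans ltr01 (node_ge1 k). Qed.

Lemma nodeS k : node k.+1 = node k + 1.
Proof. by rewrite /node -[in LHS]natr1; ring. Qed.

Lemma node0_le k : node 0 <= node k.
Proof. by rewrite /node lerD2r ler_nat. Qed.

Definition theta_term (s : R) (k : nat) : R :=
  2 * node k * s * expR (- (node k ^+ 2 * s)).

Definition theta (s : R) : R := limn (series (theta_term s)).

Lemma theta_term_ge0 s k : 0 <= s -> 0 <= theta_term s k.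
Proof. by move=> s0; rewrite !mulr_ge0 ?expR_ge0// ltW// node_gt0. Qed.

Lemma sinh_ge (y : R) : 0 <= y -> 2 * y <= expR y - expR (- y).
Proof.
move=> y0.
suff : expR 0 - expR (- 0) - 2 * 0 <= expR y - expR (- y) - 2 * y.
  by rewrite oppr0 subrr mulr0 subrr subr_ge0.
apply: (@ge0_derive_le _ (fun y => expR y - expR (- y) - 2 * y)
  (fun y => expR y + expR (- y) - 2)) => // x _.
  by apply: is_derive_eq; rewrite /= /GRing.scale/=; ring.
by have := expR_ge1Dx x; have := expR_ge1Dx (- x); lra.
Qed.

Lemma tanh_le (z : R) : 0 <= z -> 1 - expR (- z) <= z / 2 * (1 + expR (- z)).
Proof.
move=> z0; rewrite -subr_ge0.
have -> : z / 2 * (1 + expR (- z)) - (1 - expR (- z)) =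
  2^-1 * (z * (1 + expR (- z)) - 2 * (1 - expR (- z))) by field.
apply: mulr_ge0 => //.
suff : 0 * (1 + expR (- 0)) - 2 * (1 - expR (- 0)) <=
   z * (1 + expR (- z)) - 2 * (1 - expR (- z)).
  by rewrite mul0r oppr0 expR0 subrr mulr0 subrr.
apply: (@ge0_derive_le _ (fun z => z * (1 + expR (- z)) - 2 * (1 - expR (- z)))
  (fun z => 1 - (1 + z) * expR (- z))) => // x _.
  by apply: is_derive_eq; rewrite /= /GRing.scale/=; ring.
rewrite subr_ge0 expRN ler_pdivrMr ?expR_gt0// mul1r.
exact: expR_ge1Dx.
Qed.

(** The midpoint rule: a^2 is, up to 1/4, the midpoint of the interval
    between (a - 1/2)^2 and (a + 1/2)^2, whose length is the weight 2 a, and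
    exp(- s y) is convex in y.  The inequality is sinh y >= y at y = a s, and the
    bounds telescope. *)
Lemma theta_partial_le (s : R) n : 0 < s ->
  series (theta_term s) n <= 1 - expR (- ((node n ^+ 2 - node n) * s)).
Proof.
move=> s0; elim: n => [|n IH].
  rewrite /series/= big_geq// subr_ge0 -expR0 ler_expR oppr_le0.
  by rewrite mulr_ge0 ?(ltW s0)//; have := node_ge1 0; nra.
rewrite seriesSr/=; apply: le_trans (lerD IH (lexx _)) _.
rewrite /theta_term -lerBrDl.
rewrite nodeS.
have -> : - (((node n + 1) ^+ 2 - (node n + 1)) * s) = - (node n ^+ 2 * s) + -
  (node n * s) by ring.
have -> : - ((node n ^+ 2 - node n) * s) = - (node n ^+ 2 * s) + node n * s by ring.
rewrite !expRD.
have := sinh_ge (node n * s); rewrite mulr_ge0 ?(ltW s0) ?(ltW (node_gt0 _))// =>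
  /(_ isT).
have := expR_gt0 (- (node n ^+ 2 * s)).
by nra.
Qed.

Lemma theta_cvg (s : R) : 0 < s -> cvgn (series (theta_term s)).
Proof.
move=> s0; apply: (@nnseries_cvg_bounded _ _ 1).
  by move=> k; apply: theta_term_ge0; exact: ltW.
move=> n; apply: le_trans (theta_partial_le s n s0) _.
by rewrite lerBlDr lerDl expR_ge0.
Qed.

Lemma theta_ge0 (s : R) : 0 < s -> 0 <= theta s.
Proof.
move=> s0; apply: limr_ge; first exact: theta_cvg.
by near=> n; apply: sumr_ge0 => k _; apply: theta_term_ge0; exact: ltW.
Unshelve. all: by end_near. Qed.

Lemma theta_le1 (s : R) : 0 < s -> theta s <= 1.
Proof.
move=> s0; apply: nnseries_lim_le.
  by move=> k; apply: theta_term_ge0; exact: ltW.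
move=> n; apply: le_trans (theta_partial_le s n s0) _.
by rewrite lerBlDr lerDl expR_ge0.
Qed.

(** The trapezoidal rule for exp(- s y) on the intervals between consecutive
    a_k^2, of length 2 a_k + 1: each chord lies above the graph, and the two
    halves meeting at a_k^2 add up to the weight 2 a_k, except at the first point,
    where only a_0 + 1/2 <= 2 a_0 is needed. *)
Lemma theta_ge (s : R) : 0 < s -> expR (- ((u + 1) ^+ 2 * s)) <= theta s.
Proof.
move=> s0; pose e k := expR (- (node k ^+ 2 * s)).
(* The last term is what the interval below a_n^2 contributes to the weight
   there. *)
have P n : e 0 - e n <= series (theta_term s) n + (node n - 2^-1) * s * e n.
  elim: n => [|n IH].
    rewrite subrr /series/= big_geq// add0r !mulr_ge0 ?expR_ge0 ?(ltW s0)//.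
    by have := node_ge1 0; lra.
  rewrite seriesSr/= /theta_term -/(e n) nodeS.
  have : e n - e n.+1 <= (node n + 2^-1) * s * (e n + e n.+1).
    have -> : e n.+1 = e n * expR (- ((2 * node n + 1) * s)).
      by rewrite /e nodeS -expRD; congr expR; ring.
    have := tanh_le ((2 * node n + 1) * s).
    rewrite mulr_ge0 ?(ltW s0)//; last by have := node_gt0 n; lra.
    move=> /(_ isT); have := expR_gt0 (- (node n ^+ 2 * s)); rewrite -/(e n).
    set w := expR _ => en H.
    have := ler_wpM2l (ltW en) H; lra.
  by move: IH; lra.
have t0 : theta_term s k @[k --> \oo] --> 0.
  exact: cvg_series_cvg_0 (theta_cvg _ s0).
(* The added multiple of the n-th term dominates both e n and the boundary term,
   and tends to 0. *)
have b0 : e 0 <= theta s.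
  have c : series (theta_term s) n + (1 + (2 * s)^-1) * theta_term s n @[n -->
    \oo] -->
     theta s + (1 + (2 * s)^-1) * 0.
    by apply: cvgD; [exact: theta_cvg|apply: cvgM; [exact: cvg_cst|exact: t0]].
  rewrite mulr0 addr0 in c.
  apply: (cvgr_to_ge c); near=> n.
  have := P n; rewrite /theta_term -/(e n).
  have en : 0 < e n by exact: expR_gt0.
  have -> : (1 + (2 * s)^-1) * (2 * node n * s * e n) =
    2 * node n * s * e n + node n * e n by field; rewrite gt_eqF.
  have h1 : e n <= node n * e n by rewrite ler_peMl ?(ltW en)// node_ge1.
  have h2 : (node n - 2^-1) * s * e n <= 2 * node n * s * e n.
    rewrite ler_wpM2r ?(ltW en)// ler_wpM2r ?(ltW s0)//.
    by have := node_gt0 n; lra.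
  by lra.
by move: b0; rewrite /e /node addrC.
Unshelve. all: by end_near. Qed.

(** Comparing with s = 1 term by term: the factor exp(- a_k^2 (s - 1)) is
    largest for the first point. *)
Lemma theta_decay (s : R) : 1 <= s ->
  theta s <= s * expR (- ((u + 1) ^+ 2 * (s - 1))) * theta 1.
Proof.
move=> s1; have s0 : 0 < s by exact: lt_le_trans s1.
apply: nnseries_lim_le => [k|n].
  by apply: theta_term_ge0; exact: ltW.
apply: (@le_trans _ _
  (s * expR (- ((u + 1) ^+ 2 * (s - 1))) * series (theta_term 1) n)).
  rewrite /series/= mulr_sumr; apply: ler_sum => k _.
  rewrite /theta_term !mulr1.
  have -> : - (node k ^+ 2 * s) = - (node k ^+ 2 * (s - 1)) + - node k ^+ 2 by ring.
  rewrite expRD.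
  rewrite [leLHS](_ : _ = s * expR (- (node k ^+ 2 * (s - 1))) * (2 * node k *
    expR (- node k ^+ 2))); last by ring.
  apply: ler_wpM2r; first by rewrite !mulr_ge0 ?expR_ge0// ltW// node_gt0.
  apply: ler_wpM2l; first exact: ltW.
  rewrite ler_expR lerN2; apply: ler_wpM2r; first by rewrite subr_ge0.
  rewrite ler_sqr ?nnegrE ?addr_ge0//.
  by have := node0_le k; rewrite {1}/node addrC.
apply: ler_wpM2l; first by rewrite mulr_ge0 ?expR_ge0// ltW.
apply: nnseries_le_lim; last exact: theta_cvg.
by move=> k; apply: theta_term_ge0.
Qed.

Lemma theta_continuous (s : R) : 0 < s -> {for s, continuous theta}.
Proof.
move=> s0; have s2 : 0 < s / 2 by rewrite divr_gt0.
have cM : cvgn (series (4 *: theta_term (s / 2))).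
  by apply: is_cvg_seriesZ; exact: theta_cvg.
apply: (@tannery R R (nbhs s) _ theta_term (theta_term s) _ cM).
- move=> k; rewrite /theta_term; apply: cvgM.
    by apply: cvgM; [exact: cvg_cst|exact: cvg_id].
  apply: continuous_cvg; first exact: continuous_expR.
  by apply: cvgN; apply: cvgM; [exact: cvg_cst|exact: cvg_id].
- near=> z; move=> k.
  have z1 : s / 2 <= z by apply: ltW; near: z; apply: lt_nbhsr; lra.
  have z2 : z <= 2 * s by apply: ltW; near: z; apply: lt_nbhsl; lra.
  rewrite ger0_norm; last by apply: theta_term_ge0; lra.
  rewrite /theta_term.
  rewrite [leRHS](_ : _ = 2 * node k * (2 * s) * expR (- (node k ^+ 2 * (s /
    2)))); last first.
    rewrite -[LHS]/(4 * (2 * node k * (s / 2) * expR (- (node k ^+ 2 * (s / 2))))).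
    by field.
  have k0 := node_gt0 k.
  apply: ler_pM; rewrite ?expR_ge0//.
  + by rewrite !mulr_ge0//; lra.
  + by apply: ler_wpM2l => //; rewrite mulr_ge0//; lra.
  + by rewrite ler_expR lerN2; apply: ler_wpM2l => //; exact: sqr_ge0.
Unshelve. all: by end_near. Qed.

End Theta.

(** * The series S_mu as a function of t^2 *)

Section PowerSeries.
Context {R : realType}.

Let dist_between (q a b K : R) : a <= q -> q <= b -> b - a <= K ->
  `|- q + a| <= K /\ `|- q + b| <= K.
Proof. by move=> *; rewrite !ler_norml; split; apply/andP; split; lra. Qed.

(** The mean value theorem for y^(-n), whose derivative is monotone. *)
Lemma powRN_mvt (n y z : R) : 0 < n -> 0 < y -> y <= z ->
  n * (z - y) / z `^ (n + 1) <= y `^ (- n) - z `^ (- n)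
    <= n * (z - y) / y `^ (n + 1).
Proof.
move=> n0 y0 yz.
have [| |c] := @MVT_segment R (fun x => x `^ (- n)) (fun x =>
  - n * x `^ (- n - 1)) y z yz.
- by move=> x; rewrite in_itv/= => /andP[yx _]; apply: is_derive1_powR; lra.
- apply: derivable_within_continuous => x; rewrite in_itv/= => /andP[yx _].
  by apply: ex_derive; apply: is_derive1_powR; lra.
rewrite in_itv/= => /andP[yc cz] /= E.
have c0 : 0 < c by lra.
have -> : y `^ (- n) - z `^ (- n) = n * (z - y) * c `^ (- n - 1).
  by rewrite -opprB E; ring.
rewrite -opprD powRN.
have nzy : 0 <= n * (z - y) by rewrite mulr_ge0 ?subr_ge0// ltW.
by rewrite !ler_wpM2l// lef_pV2 ?posrE ?powR_gt0 ?(lt_le_trans y0)//;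
  apply: ge0_ler_powR; rewrite ?nnegrE; lra.
Qed.

Variable u : R.
Hypothesis u0 : 0 <= u.
Notation node := (node u).

Definition S_term (m y : R) (k : nat) : R :=
  2 * node k / (node k ^+ 2 + y) `^ (m + 1).

(** S_mu as a function of y = t^2: differentiating in y only shifts mu by one
    and brings out a constant (is_derive_S_sq). *)
Definition S_sq (m y : R) : R := limn (series (S_term m y)).

Lemma S_muE (m t : R) : S_mu m t u = S_sq m (t ^+ 2).
Proof. by []. Qed.

Let sq_gt0 k (y : R) : 0 <= y -> 0 < node k ^+ 2 + y.
Proof. by move=> y0; rewrite ltr_wpDr// exprn_gt0// node_gt0. Qed.

Lemma S_term_gt0 m y k : 0 <= y -> 0 < S_term m y k.
Proof.
move=> y0; rewrite /S_term divr_gt0 ?powR_gt0 ?sq_gt0// mulr_gt0//.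
exact: node_gt0.
Qed.

Lemma S_term_ge0 m y k : 0 <= y -> 0 <= S_term m y k.
Proof. by move=> y0; apply: ltW; exact: S_term_gt0. Qed.

Lemma S_term_le m y z k : 0 <= m -> 0 <= y -> y <= z ->
  S_term m z k <= S_term m y k.
Proof.
move=> m0 y0 yz; rewrite /S_term ler_wpM2l ?mulr_ge0 ?(ltW (node_gt0 _ _ _))//.
have ? := sq_gt0 k y y0.
have ? := sq_gt0 k z (le_trans y0 yz).
rewrite lef_pV2 ?posrE ?powR_gt0//; apply: ge0_ler_powR; rewrite ?nnegrE; lra.
Qed.

(** By powRN_mvt between consecutive squares the terms at y = 0 are bounded
    by a telescoping sum; the factor 2 covers 2 a <= 2 (2 a - 1). *)
Lemma S_term_cvg (m y : R) : 0 < m -> 0 <= y -> cvgn (series (S_term m y)).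
Proof.
move=> m0 y0.
apply: (@series_le_cvg _ _ (S_term m 0)).
- by move=> k; exact: S_term_ge0.
- by move=> k; exact: S_term_ge0.
- by move=> k; apply: S_term_le => //; exact: ltW.
apply: (@nnseries_cvg_bounded _ _ (S_term m 0 0 + 2 / m * (node 0 ^+ 2) `^ (- m))).
  by move=> k; exact: S_term_ge0.
have P n : series (S_term m 0) n.+1 <=
    S_term m 0 0 + 2 / m * ((node 0 ^+ 2) `^ (- m) - (node n ^+ 2) `^ (- m)).
  elim: n => [|n IH]; first by rewrite /series/= big_nat1 subrr mulr0 addr0.
  have a0 := node_gt0 _ u0 n.
  have a1 := node_ge1 _ u0 n.
  have h0 : 0 < node n ^+ 2 by rewrite exprn_gt0.
  have h1 : node n ^+ 2 <= node n.+1 ^+ 2 by rewrite nodeS; nra.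
  have /andP[H _] := powRN_mvt m _ _ m0 h0 h1.
  have m2 : 0 <= 2 / m by rewrite divr_ge0// ltW.
  have {H}H := ler_wpM2l m2 H.
  have H3 : S_term m 0 n.+1 <=
      2 / m * (m * (node n.+1 ^+ 2 - node n ^+ 2) / (node n.+1 ^+ 2) `^ (m + 1)).
    rewrite /S_term addr0 [leRHS]mulrA; apply: ler_wpM2r.
      by rewrite invr_ge0 powR_ge0.
    rewrite mulrA divfK ?gt_eqF// nodeS.
    by nra.
  rewrite seriesSr/=.
  by move: IH (le_trans H3 H); lra.
move=> n; apply: (@le_trans _ _ (series (S_term m 0) n.+1)).
  by rewrite seriesSr/= lerDl S_term_ge0.
apply: le_trans (P n) _; rewrite lerD2l ler_wpM2l//.
  by rewrite divr_ge0// ltW.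
by rewrite lerBlDr lerDl powR_ge0.
Qed.

Lemma S_sq_gt0 (m y : R) : 0 < m -> 0 <= y -> 0 < S_sq m y.
Proof.
move=> m0 y0; apply: (@lt_le_trans _ _ (series (S_term m y) 1)).
  by rewrite /series/= big_nat1 S_term_gt0.
by apply: nnseries_le_lim; [move=> k; exact: S_term_ge0|exact: S_term_cvg].
Qed.

(** The sum of the inequalities powRN_mvt over all terms.  It gives
    monotonicity, the Lipschitz bound and the derivative of S_sq without
    differentiating a series term by term. *)
Lemma S_sq_mvt (m y z : R) : 0 < m -> 0 <= y -> y <= z ->
  (m + 1) * (z - y) * S_sq (m + 1) z <= S_sq m y - S_sq m z
    <= (m + 1) * (z - y) * S_sq (m + 1) y.
Proof.
move=> m0 y0 yz; have z0 := le_trans y0 yz.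
have m1 : 0 < m + 1 by lra.
have cy := S_term_cvg m y m0 y0; have cz := S_term_cvg m z m0 z0.
have cy1 := S_term_cvg (m + 1) y m1 y0; have cz1 := S_term_cvg (m + 1) z m1 z0.
have cE := series_cvgB _ _ cy cz.
have cZ x (x0 : 0 <= x) := series_cvgZ _ ((m + 1) * (z - y)) (S_term_cvg (m + 1)
  x m1 x0).
have T k : ((m + 1) * (z - y)) * S_term (m + 1) z k <= S_term m y k - S_term m z k
   <= ((m + 1) * (z - y)) * S_term (m + 1) y k.
  have h0 := sq_gt0 k y y0.
  have h1 : node k ^+ 2 + y <= node k ^+ 2 + z by rewrite lerD2l.
  have /andP[H1 H2] := powRN_mvt (m + 1) _ _ m1 h0 h1.
  have s0 : 0 <= 2 * node k by rewrite mulr_ge0// ltW// node_gt0.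
  rewrite /S_term -!powRN -mulrBr.
  have e : node k ^+ 2 + z - (node k ^+ 2 + y) = z - y by ring.
  rewrite e -!powRN in H1 H2.
  apply/andP; split.
    apply: le_trans (ler_wpM2l s0 H1); rewrite le_eqVlt; apply/orP; left.
    by apply/eqP; ring.
  apply: le_trans (ler_wpM2l s0 H2) _; rewrite le_eqVlt; apply/orP; left.
  by apply/eqP; ring.
apply/andP; split.
- apply: (ler_cvg_to (cZ z z0) cE); near=> n; apply: ler_sum => k _.
  by have /andP[] := T k.
- apply: (ler_cvg_to cE (cZ y y0)); near=> n; apply: ler_sum => k _.
  by have /andP[] := T k.
Unshelve. all: by end_near. Qed.

Lemma S_sq_le (m y z : R) : 0 < m -> 0 <= y -> y <= z -> S_sq m z <= S_sq m y.
Proof.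
move=> m0 y0 yz; have /andP[H _] := S_sq_mvt m y z m0 y0 yz.
rewrite -subr_ge0; apply: le_trans H; rewrite !mulr_ge0 ?subr_ge0//; first by lra.
by apply: ltW; apply: S_sq_gt0; lra.
Qed.

(** By S_sq_mvt a difference quotient lies between the values of
    - (m + 1) S_sq (m + 1) at its two ends, and this function is Lipschitz, again
    by S_sq_mvt. *)
Lemma is_derive_S_sq (m y : R) : 0 < m -> 0 < y ->
  is_derive y 1 (S_sq m) (- ((m + 1) * S_sq (m + 1) y)).
Proof.
move=> m0 y0; have m1 : 0 < m + 1 by lra.
apply/is_derive1_caratheodory.
pose L := (m + 1) * S_sq (m + 1) y.
pose gg (z : R) : R := if z == y then - L else (S_sq m z - S_sq m y) / (z - y).
have bnd (z : R) : 0 < z -> `|gg z - gg y| <=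
   (m + 1) * ((m + 1 + 1) * S_sq (m + 1 + 1) 0) * `|z - y|.
  move=> z0.
  have K0 : 0 <= (m + 1) * ((m + 1 + 1) * S_sq (m + 1 + 1) 0).
    rewrite !mulr_ge0 ?(ltW (S_sq_gt0 _ _ _ _))//; lra.
  have [->|zy] := eqVneq z y; first by rewrite subrr normr0 mulr_ge0.
  have lip (a b : R) : 0 < a -> a <= b -> S_sq (m + 1) a - S_sq (m + 1) b <=
      (m + 1 + 1) * S_sq (m + 1 + 1) 0 * (b - a).
    move=> a0 ab; have /andP[_ H] := S_sq_mvt (m + 1) a b m1 (ltW a0) ab.
    apply: le_trans H _.
    rewrite -[leLHS]mulrA -[leRHS]mulrA; apply: ler_wpM2l; first by lra.
    rewrite mulrC; apply: ler_wpM2r; first by rewrite subr_ge0.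
    by apply: S_sq_le; lra.
  rewrite /gg eqxx (negbTE zy) opprK.
  have [zy'|yz'] := ltP z y.
  - have /andP[H1 H2] := S_sq_mvt m z y m0 (ltW z0) (ltW zy').
    have yz0 : 0 < y - z by rewrite subr_gt0.
    have -> : (S_sq m z - S_sq m y) / (z - y) = - ((S_sq m z - S_sq m y) / (y - z)).
      by rewrite -[z - y]opprB invrN mulrN.
    have -> : `|z - y| = y - z by rewrite distrC gtr0_norm.
    rewrite /L.
    have H3 := lip _ _ z0 (ltW zy').
    have H1' : (m + 1) * S_sq (m + 1) y <= (S_sq m z - S_sq m y) / (y - z).
      by rewrite (ler_pdivlMr _ _ yz0) mulrAC; exact: H1.
    have H2' : (S_sq m z - S_sq m y) / (y - z) <= (m + 1) * S_sq (m + 1) z.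
      by rewrite (ler_pdivrMr _ _ yz0) mulrAC; exact: H2.
    have H4 := ler_wpM2l (ltW m1) H3; rewrite mulrBr mulrA in H4.
    have [X1 X2] := dist_between _ _ _ _ H1' H2' H4. exact: X1.
  - have yz : y < z by rewrite lt_neqAle eq_sym zy.
    have /andP[H1 H2] := S_sq_mvt m y z m0 (ltW y0) yz'.
    have zy0 : 0 < z - y by rewrite subr_gt0.
    rewrite (gtr0_norm zy0) /L.
    have e : (S_sq m z - S_sq m y) / (z - y) = - ((S_sq m y - S_sq m z) / (z - y)).
      by rewrite -mulNr opprB.
    rewrite e.
    have H3 := lip _ _ y0 yz'.
    have H1' : (m + 1) * S_sq (m + 1) z <= (S_sq m y - S_sq m z) / (z - y).
      by rewrite (ler_pdivlMr _ _ zy0) mulrAC; exact: H1.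
    have H2' : (S_sq m y - S_sq m z) / (z - y) <= (m + 1) * S_sq (m + 1) y.
      by rewrite (ler_pdivrMr _ _ zy0) mulrAC; exact: H2.
    have H4 := ler_wpM2l (ltW m1) H3; rewrite mulrBr mulrA in H4.
    have [X1 X2] := dist_between _ _ _ _ H1' H2' H4. exact: X2.
exists gg; split; last by rewrite /gg eqxx.
- move=> z; rewrite /gg; case: eqVneq => [->|zy]; first by rewrite !subrr mulr0.
  by rewrite divfK// subr_eq0.
- have : 0 <= (m + 1) * ((m + 1 + 1) * S_sq (m + 1 + 1) 0).
    by rewrite !mulr_ge0 ?(ltW (S_sq_gt0 _ _ _ _))//; lra.
  move: bnd; move: ((m + 1) * _) => K' bnd K0.
  apply/cvgrPdist_le => e e0; near=> z.
  have z0 : 0 < z by near: z; exact: lt_nbhsr.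
  rewrite distrC; apply: le_trans (bnd z z0) _.
  have : `|z - y| <= e / (K' + 1).
    near: z; apply/nbhs_ballP; exists (e / (K' + 1)) => /=.
      by rewrite divr_gt0//; lra.
    by move=> z; rewrite /ball/= distrC => /ltW.
  rewrite ler_pdivlMr; last lra.
  have := normr_ge0 (z - y); nra.
Unshelve. all: by end_near. Qed.

End PowerSeries.

(** * The Mellin transform of theta and its inversion *)

Section GammaLink.
Context {R : realType}.
Notation mu := (@lebesgue_measure R).

Lemma powRS (a m : R) : 0 < a -> a `^ (m + 1) = a `^ m * a.
Proof.
by move=> a0; rewrite powRD ?powRr1 ?(ltW a0)// (gt_eqF a0) implybT.
Qed.

(** Scaling and the recurrence of the Gamma function in the form of explicit
    primitives: with P a primitive of v^m exp(- v), they are c^(-m-1) P(c s) and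
    (s^m exp(- c s) + c^(-m) P(c s)) / m.  The number G is Gamma(m + 1). *)
Lemma gamma_integrals (m : R) : 0 < m ->
  exists2 G : R, 0 < G & forall c : R, 0 < c ->
  (\int[mu]_(s in `](0%R:R), +oo[) (s `^ m * expR (- (c * s)))%:E =
     (G * c `^ (- (m + 1)))%:E)%E /\
  (\int[mu]_(s in `](0%R:R), +oo[) (s `^ (m - 1) * expR (- (c * s)))%:E =
     (G / m * c `^ (- m))%:E)%E.
Proof.
move=> m0; have [P [l0 [l1 [l01 dP P0 P1]]]] := @gamma_primitive R m m0.
exists (l1 - l0); first by rewrite subr_gt0.
move=> c c0.
have cm0 : c `^ m != 0 by rewrite gt_eqF// powR_gt0.
have m0' : m != 0 by rewrite gt_eqF.
have c0' : c != 0 by rewrite gt_eqF.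
have cE : c `^ (- (m + 1)) = (c `^ m * c)^-1 by rewrite powRN powRS.
have dPc (s : R) : 0 < s -> is_derive s 1 (fun s => P (c * s))
    ((c * s) `^ m * expR (- (c * s)) * c).
  move=> s0; have cs : 0 < c * s by rewrite mulr_gt0.
  have := dP _ cs => d1.
  have d2 : is_derive s 1 (fun s => c * s) c.
    by apply: is_derive_eq; rewrite /= /GRing.scale/= mulr1.
  exact: (@is_derive1_comp _ P (fun s => c * s)).
have ce (z : R) : {for z, continuous (fun s => expR (- (c * s)))}.
  apply: continuous_comp; last exact: continuous_expR.
  by apply: cvgN; apply: cvgM; [exact: cvg_cst|exact: cvg_id].
have Pc0 : P (c * s) @[s --> 0^'+] --> l0.
  apply: (@cvg_comp _ _ _ (fun s => c * s) P _ (0^'+)); last exact: P0.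
  move=> A [d /= d0 dA]; exists (d / c); first by rewrite /= divr_gt0.
  move=> z /=; rewrite sub0r normrN => zd z0; apply: dA => /=;
    last by rewrite mulr_gt0.
  by rewrite sub0r normrN normrM (gtr0_norm c0) mulrC -ltr_pdivlMr.
have Pc1 : P (c * s) @[s --> +oo] --> l1.
  by apply: cvg_comp P1; apply: gt0_cvgMry => //; exact: cvg_id.
have se0 : s `^ m * expR (- (c * s)) @[s --> 0^'+] --> 0.
  rewrite -[X in _ --> X](mul0r (expR (- (c * 0)))); apply: cvgM;
    first exact: powR_cvg0.
  by apply: cvg_at_right_filter; exact: ce.
have se1 : s `^ m * expR (- (c * s)) @[s --> +oo] --> 0.
  have z1 : expR (- (c / 2 * s)) @[s --> +oo] --> 0.
    apply: (cvg_comp _ _ _ (@cvgr_expR R)).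
    by apply: gt0_cvgMry; [rewrite divr_gt0|exact: cvg_id].
  have z2 : c `^ (- m) * (2 * m) `^ m * expR (- (c / 2 * s)) @[s --> +oo] --> 0.
    rewrite -[X in _ --> X](mulr0 (c `^ (- m) * (2 * m) `^ m)).
    by apply: cvgM; [exact: cvg_cst|exact: z1].
  apply: (squeeze_cvgr _ (cvg_cst 0) z2); near=> s.
  have s0 : 0 < s by near: s; apply: nbhs_pinfty_gt; rewrite num_real.
  rewrite mulr_ge0 ?powR_ge0 ?expR_ge0//=.
  have cs : 0 < c * s by rewrite mulr_gt0.
  have := powR_expR_le m (c * s) m0 cs.
  rewrite powRM ?(ltW c0) ?(ltW s0)// => H.
  have H2 := ler_wpM2l (powR_ge0 c (- m)) H.
  move: H2; rewrite !mulrA powRN mulVf// mul1r.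
  by rewrite (mulrAC c s).
have cp (z : R) : 0 < z -> {for z, continuous (fun s : R => s `^ m)}.
  by move=> z0; exact: is_derive_continuous (is_derive1_powR _ z0).
split.
- rewrite (_ : (l1 - l0) * _ = c `^ (- (m + 1)) * l1 - c `^ (- (m + 1)) * l0);
    last by ring.
  apply: (@ge0_FTC_0y R (fun s => s `^ m * expR (- (c * s)))
    (fun s => c `^ (- (m + 1)) * P (c * s))).
  + by move=> s s0; rewrite mulr_ge0 ?powR_ge0 ?expR_ge0.
  + by move=> s s0; apply: cvgM; [exact: cp|exact: ce].
  + move=> s s0; have := dPc s s0 => d1.
    apply: is_derive_eq; rewrite /= /GRing.scale/=.
    rewrite powRM ?(ltW c0) ?(ltW s0)// cE.
    by field; rewrite c0' cm0.
  + by apply: cvgM; [exact: cvg_cst|exact: Pc0].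
  + by apply: cvgM; [exact: cvg_cst|exact: Pc1].
- rewrite (_ : (l1 - l0) / m * _ = (0 / m + c / m * c `^ (- (m + 1)) * l1) -
     (0 / m + c / m * c `^ (- (m + 1)) * l0)); last first.
    by rewrite cE powRN; field; rewrite ?m0' ?cm0 ?c0'.
  apply: (@ge0_FTC_0y R (fun s => s `^ (m - 1) * expR (- (c * s)))
    (fun s => s `^ m * expR (- (c * s)) / m + c / m * c `^ (- (m + 1)) * P (c *
      s))).
  + by move=> s s0; rewrite mulr_ge0 ?powR_ge0 ?expR_ge0.
  + move=> s s0; apply: cvgM; last exact: ce.
    exact: is_derive_continuous (is_derive1_powR _ s0).
  + move=> s s0; have := dPc s s0 => d1.
    have := is_derive1_powR m s0 => d2.
    apply: is_derive_eq; rewrite /= /GRing.scale/=.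
    rewrite powRM ?(ltW c0) ?(ltW s0)// cE.
    by field; rewrite c0' m0' cm0.
  + apply: cvgD; first by apply: cvgM; [exact: se0|exact: cvg_cst].
    by apply: cvgM; [exact: cvg_cst|exact: Pc0].
  + apply: cvgD; first by apply: cvgM; [exact: se1|exact: cvg_cst].
    by apply: cvgM; [exact: cvg_cst|exact: Pc1].
Unshelve. all: by end_near. Qed.

Variable u : R.
Hypothesis u0 : 0 <= u.
Notation node := (node u).
Notation theta := (theta u).
Notation S_sq := (S_sq u).

(** Each term is a Gamma integral with c replaced by c + q a_k^2. *)
Lemma theta_gamma (m : R) : 0 < m -> exists2 G : R, 0 < G &
  (forall c : R, 0 < c ->
    (\int[mu]_(s in `](0%R:R), +oo[) (s `^ (m - 1) * expR (- (c * s)))%:E =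
     (G / m * c `^ (- m))%:E)%E) /\
  (forall c q : R, 0 <= c -> 0 < q ->
    (\int[mu]_(s in `](0%R:R), +oo[)
        (s `^ (m - 1) * expR (- (c * s)) * theta (q * s))%:E =
     (G * (q `^ (- m) * S_sq m (c / q)))%:E)%E).
Proof.
move=> m0; have [G G0 H] := gamma_integrals m m0.
exists G => //; split; first by move=> c c0; have [] := H c c0.
move=> c q c0 q0.
have cq0 : 0 <= c / q by rewrite divr_ge0// ltW.
have cS := S_term_cvg u u0 m (c / q) m0 cq0.
have cI := series_cvgZ _ (G * q `^ (- m)) cS.
rewrite mulrA -(cvg_lim _ cI)//.
pose f (k : nat) (s : R) := s `^ (m - 1) * expR (- (c * s)) * theta_term u (q *
  s) k.
have fE (k : nat) (s : R) : 0 < s -> f k s =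
    2 * node k * q * (s `^ m * expR (- ((c + q * node k ^+ 2) * s))).
  move=> s0; rewrite /f /theta_term -[in RHS](mulr_powRB1 (ltW s0) m0).
  have -> : expR (- ((c + q * node k ^+ 2) * s)) =
      expR (- (c * s)) * expR (- (node k ^+ 2 * (q * s))).
    by rewrite -expRD; congr expR; ring.
  by ring.
have mE (b : R) : measurable_fun setT (fun s : R => expR (- (b * s))).
  apply: measurableT_comp; first exact: measurable_expR.
  by apply: measurableT_comp => //; apply: measurable_funM.
transitivity (\int[mu]_(s in `](0%R:R), +oo[) (limn (series (f^~ s)))%:E)%E.
  apply: eq_integral => s; rewrite inE/= in_itv/= andbT => s0; congr EFin.
  apply/esym; apply: cvg_lim => //.
  apply: series_cvgZ; apply: theta_cvg => //.
  exact: mulr_gt0.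
apply: integral_series.
- exact: measurable_itv.
- move=> k; apply: measurable_funTS; apply: measurable_funM.
    by apply: measurable_funM; [exact: measurable_powR|exact: mE].
  apply: measurable_funM.
    by apply: measurable_funM => //; apply: measurable_funM.
  rewrite (_ : (fun _ => _) = fun s => expR (- (node k ^+ 2 * q * s)));
    first exact: mE.
  by apply/funext => s; rewrite mulrA.
- move=> k s; rewrite /= in_itv/= andbT => s0.
  rewrite mulr_ge0 ?theta_term_ge0 ?mulr_ge0 ?powR_ge0 ?expR_ge0//; exact: ltW.
- move=> s; rewrite /= in_itv/= andbT => s0.
  apply: cvgP; apply: series_cvgZ; apply: theta_cvg => //.
  exact: mulr_gt0.
- move=> k; have k0 := node_gt0 u u0 k.
  have ck : 0 < c + q * node k ^+ 2 by rewrite ltr_wpDl// mulr_gt0// exprn_gt0.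
  have [H1 _] := H _ ck.
  transitivity (\int[mu]_(s in `](0%R:R), +oo[)
     ((2 * node k * q)%:E * (s `^ m * expR (- ((c + q * node k ^+ 2) * s)))%:E))%E.
    by apply: eq_integral => s; rewrite inE/= in_itv/= andbT => s0;
      rewrite fE// EFinM.
  rewrite ge0_integralZl_EFin//.
  + rewrite H1 -EFinM; congr EFin; rewrite /S_term.
    have -> : c + q * node k ^+ 2 = q * (node k ^+ 2 + c / q).
      by field; rewrite gt_eqF.
    have h0 : 0 < node k ^+ 2 + c / q by rewrite ltr_wpDr// exprn_gt0.
    rewrite powRM ?(ltW q0) ?(ltW h0)// !powRN powRS//.
    by field; rewrite !gt_eqF ?powR_gt0.
  + by move=> s _; rewrite lee_fin mulr_ge0 ?powR_ge0 ?expR_ge0.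
  + apply/measurable_EFinP; apply: measurable_funTS.
    by apply: measurable_funM; [exact: measurable_powR|exact: mE].
  + by rewrite !mulr_ge0// ltW.
- by apply: cvgP cI.
Qed.

(** The exponents mu of the limit are even integers, so that the dominating
    series comes from Bernoulli's inequality with an integer exponent. *)
Definition evn (n : nat) : R := (2 * n.+1)%:R.

Lemma evn_gt0 n : 0 < evn n. Proof. by rewrite ltr0n. Qed.

Lemma evn_inv_cvg (K : R) : K / evn n @[n --> \oo] --> 0.
Proof.
rewrite (_ : (fun n => _) = (fun n => K / 2 * n.+1%:R^-1)).
  rewrite -[X in _ --> X](mulr0 (K / 2)); apply: cvgM; first exact: cvg_cst.
  exact: cvg_harmonic.
by apply/funext => n; rewrite /evn natrM invfM mulrA.
Qed.

(** The error is at most (x^2 + c x) / m, by y / (1 + y) <= ln (1 + y) <= y. *)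
Lemma evn_ln_cvg (x c : R) : 0 <= x -> 0 <= c ->
  (evn n + c) * ln (1 + x / evn n) @[n --> \oo] --> x.
Proof.
move=> x0 c0; apply/cvgrPdist_le => e e0.
have /cvgrPdist_le/(_ e e0) H := evn_inv_cvg (x ^+ 2 + c * x).
near=> n.
have m0 := evn_gt0 n.
have : (x ^+ 2 + c * x) / evn n <= e.
  have : `|0 - (x ^+ 2 + c * x) / evn n| <= e by near: n.
  by rewrite sub0r normrN => /(le_trans (ler_norm _)).
apply: le_trans.
move: (evn n) m0 => m m0.
have y0 : 0 <= x / m by rewrite divr_ge0// ltW.
have up : ln (1 + x / m) <= x / m by apply: le_ln1Dx; apply: lt_le_trans y0;
  rewrite ltrN10.
have lo : x / (m + x) <= ln (1 + x / m).
  rewrite -lerN2 -lnV; last by rewrite posrE ltr_pwDl.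
  have -> : (1 + x / m)^-1 = 1 + - (x / (m + x)) by field; lra.
  apply: le_ln1Dx; rewrite ltrN2 ltr_pdivrMr; lra.
have mc : 0 <= m + c by lra.
have up2 := ler_wpM2l mc up.
have lo2 := ler_wpM2l mc lo.
have E : (x ^+ 2 + c * x) / m = x ^+ 2 / m + c * x / m by rewrite mulrDl.
rewrite ler_norml; apply/andP; split.
- have e1 : (m + c) * (x / m) = x + c * x / m by field; rewrite gt_eqF.
  have : 0 <= x ^+ 2 / m by rewrite divr_ge0 ?sqr_ge0// ltW.
  by move: up2; rewrite e1 E; lra.
- have : x - (m + c) * (x / (m + x)) <= x ^+ 2 / m.
    have -> : x - (m + c) * (x / (m + x)) = (x ^+ 2 - c * x) / (m + x) by field;
      lra.
    apply: (@le_trans _ _ (x ^+ 2 / (m + x))).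
      apply: ler_wpM2r; first by rewrite invr_ge0; lra.
      by rewrite lerBlDr lerDl mulr_ge0.
    by apply: ler_wpM2l; [exact: sqr_ge0|rewrite lef_pV2 ?posrE; lra].
  have : 0 <= c * x / m by rewrite divr_ge0 ?mulr_ge0// ltW.
  by move: lo2; rewrite E; lra.
Unshelve. all: by end_near. Qed.

Lemma evn_powRN_cvg (x c : R) : 0 <= x -> 0 <= c ->
  (1 + x / evn n) `^ (- (evn n + c)) @[n --> \oo] --> expR (- x).
Proof.
move=> x0 c0.
rewrite (_ : (fun n => _) = (fun n => expR (- ((evn n + c) * ln (1 + x / evn n))))).
  apply: continuous_cvg; first exact: continuous_expR.
  by apply: cvgN; exact: evn_ln_cvg.
apply/funext => n; rewrite /powR gt_eqF ?mulNr//.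
by rewrite ltr_wpDr// divr_ge0// ltW// evn_gt0.
Qed.

Lemma bernoulli (y : R) n : 0 <= y -> 1 + n%:R * y <= (1 + y) ^+ n.
Proof.
move=> y0; elim: n => [|n IH]; first by rewrite mul0r addr0 expr0.
rewrite exprS -natr1; have : 0 <= n%:R :> R by [].
have y1 : 0 <= 1 + y by lra.
have := ler_wpM2l y1 IH.
by move=> H H2; apply: le_trans H; nra.
Qed.

(** The factor (mu/s)^(mu+1) cancels in the k-th term, which becomes
    2 a_k s (1 + a_k^2 s / mu)^(-mu-1), which tends to the k-th term of theta.  By
    Bernoulli, (1 + x/mu)^mu >= (1 + x/2)^2 for even mu, so the terms of S_1(0)
    dominate. *)
Lemma limit_theta (s : R) : 0 < s ->
  evn n * (evn n / s) `^ (evn n) * S_sq (evn n) (evn n / s) @[n --> \oo] -->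
    theta s.
Proof.
move=> s0.
pose L (n k : nat) := 2 * node k * s * (1 + node k ^+ 2 * s / evn n) `^ (- (evn n
  + 1)).
have x0 k : 0 <= node k ^+ 2 * s by rewrite mulr_ge0 ?sqr_ge0// ltW.
have x1 n k : 0 < 1 + node k ^+ 2 * s / evn n.
  by rewrite ltr_wpDr// divr_ge0// ltW// evn_gt0.
rewrite (_ : (fun n => _) = (fun n => limn (series (L n)))); last first.
  apply/funext => n; have m0 := evn_gt0 n.
  have ms0 : 0 < evn n / s by rewrite divr_gt0.
  have cS := S_term_cvg u u0 (evn n) (evn n / s) m0 (ltW ms0).
  rewrite -(cvg_lim _ (series_cvgZ _ (evn n * (evn n / s) `^ evn n) cS))//.
  congr (limn (series _)); apply/funext => k; rewrite /S_term /L.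
  have -> : node k ^+ 2 + evn n / s = evn n / s * (1 + node k ^+ 2 * s / evn n).
    by field; rewrite !gt_eqF.
  rewrite (powRM _ (ltW ms0) (ltW (x1 n k))) powRN !powRS ?x1//.
  move: (evn n) m0 ms0 (x1 n k) {cS} => m m0 ms0 x1m.
  have ms : 0 < m + node k ^+ 2 * s by rewrite ltr_wpDr.
  by field; rewrite ?(gt_eqF m0) ?(gt_eqF s0) ?(gt_eqF ms) ?(gt_eqF (powR_gt0 _
    x1m)) ?(gt_eqF (powR_gt0 _ ms0)).
have cM := series_cvgZ _ (4 / s) (S_term_cvg u u0 1 0 ltr01 (lexx 0)).
apply: (@tannery R nat \oo _ L (theta_term u s) _ (cvgP _ cM)).
- move=> k; rewrite /L /theta_term; apply: cvgM; first exact: cvg_cst.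
  by apply: evn_powRN_cvg.
- near=> n => k; rewrite ger0_norm; last first.
    by rewrite !mulr_ge0 ?powR_ge0// ltW// node_gt0.
  have k0 := node_gt0 u u0 k.
  rewrite /L /S_term addr0 -[1 + 1 : R]/(2%:R) powR_mulrn ?sqr_ge0//.
  set x := node k ^+ 2 * s.
  have xp : 0 < x by rewrite mulr_gt0// exprn_gt0.
  have B : (x / 2) ^+ 2 <= (1 + x / evn n) `^ (evn n + 1).
    rewrite powRS ?x1//.
    apply: (@le_trans _ _ ((1 + x / evn n) `^ (evn n))); last first.
      rewrite ler_peMr ?powR_ge0// lerDl divr_ge0// ?ltW// evn_gt0.
    have -> : (1 + x / evn n) `^ evn n = ((1 + x / evn n) ^+ n.+1) ^+ 2.
      by rewrite [X in _ `^ X]/evn powR_mulrn ?(ltW (x1 _ _))// -exprM mulnC.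
    have := bernoulli (x / evn n) n.+1.
    rewrite divr_ge0 ?(ltW xp) ?(ltW (evn_gt0 _))// => /(_ isT) H.
    have e : n.+1%:R * (x / evn n) = x / 2.
      by rewrite /evn natrM; field.
    rewrite e in H.
    have h1 : 0 <= x / 2 by rewrite divr_ge0// ltW.
    have h2 : 0 <= (1 + x / evn n) ^+ n.+1 by rewrite exprn_ge0// ltW// x1.
    rewrite ler_sqr ?nnegrE//.
    by apply: le_trans H; rewrite lerDr.
  have x2 : 0 < (x / 2) ^+ 2 by rewrite exprn_gt0// divr_gt0.
  rewrite powRN.
  apply: (@le_trans _ _ (2 * node k * s / (x / 2) ^+ 2)).
    apply: ler_wpM2l; first by rewrite !mulr_ge0// ltW.
    have x1n : 0 < 1 + x / evn n := x1 n k.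
    by rewrite lef_pV2 ?posrE ?powR_gt0.
  rewrite /x le_eqVlt; apply/orP; left; apply/eqP.
  by field; rewrite !gt_eqF.
Unshelve. all: by end_near. Qed.

End GammaLink.

(** * Inequalities for theta against inequalities for S_mu *)

Section Links.
Context {R : realType}.
Notation mu := (@lebesgue_measure R).

Lemma ge0_le_int_0y (f g : R -> R) :
  (forall x : R, 0 < x -> 0 <= f x) ->
  (forall x : R, 0 < x -> {for x, continuous f}) ->
  (forall x : R, 0 < x -> {for x, continuous g}) ->
  (forall x : R, 0 < x -> f x <= g x) ->
  (\int[mu]_(x in `](0%R:R), +oo[) (f x)%:E <= \int[mu]_(x in `](0%R:R), +oo[) (g
    x)%:E)%E.
Proof.
move=> f0 cf cg fg.
have m (k : R -> R) : (forall x : R, 0 < x -> {for x, continuous k}) ->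
    measurable_fun `](0:R), +oo[ k.
  move=> ck; apply: open_continuous_measurable_fun => // x.
  by rewrite inE/= in_itv/= andbT; exact: ck.
apply: ge0_le_integral => //.
- by move=> x; rewrite /= in_itv/= andbT lee_fin; exact: f0.
- by apply/measurable_EFinP; exact: m.
- by apply/measurable_EFinP; exact: m.
- by move=> x; rewrite /= in_itv/= andbT lee_fin; exact: fg.
Qed.

Variable u : R.
Hypothesis u0 : 0 <= u.
Notation node := (node u).
Notation theta := (theta u).
Notation S_sq := (S_sq u).

Let evn_factor (q s : R) n : 0 <= q -> 0 < s ->
  (evn n / s) `^ (evn n) * (q + evn n / s) `^ (- evn n) =
  (1 + q * s / evn n) `^ (- (evn n + 0)).
Proof.
move=> q0 s0; rewrite addr0; have := evn_gt0 (R:=R) n; move: (evn n) => m m0.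
have ms0 : 0 < m / s by rewrite divr_gt0.
have q1 : 0 < 1 + q * s / m by rewrite ltr_wpDr// divr_ge0 ?mulr_ge0// ltW.
have -> : q + m / s = m / s * (1 + q * s / m) by field; rewrite !gt_eqF.
rewrite (powRM _ (ltW ms0) (ltW q1)) mulrA.
by rewrite powRN mulfV ?mul1r// gt_eqF// powR_gt0.
Qed.

Lemma theta_le_of_S (q : R) : 0 <= q ->
  (forall m y : R, 0 < m -> 0 < y -> m * S_sq m y <= (q + y) `^ (- m)) ->
  forall s : R, 0 < s -> theta s <= expR (- (q * s)).
Proof.
move=> q0 H s s0.
have qs : 0 <= q * s by rewrite mulr_ge0// ltW.
apply: (ler_cvg_to (limit_theta u u0 s s0) (evn_powRN_cvg _ 0 qs (lexx 0))).
near=> n; have m0 := evn_gt0 (R:=R) n.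
rewrite -evn_factor// mulrAC mulrC; apply: ler_wpM2l; first exact: powR_ge0.
by apply: H => //; rewrite divr_gt0.
Unshelve. all: by end_near. Qed.

Lemma theta_ge_of_S (q : R) : 0 <= q ->
  (forall m y : R, 0 < m -> 0 < y -> (q + y) `^ (- m) <= m * S_sq m y) ->
  forall s : R, 0 < s -> expR (- (q * s)) <= theta s.
Proof.
move=> q0 H s s0.
have qs : 0 <= q * s by rewrite mulr_ge0// ltW.
apply: (ler_cvg_to (evn_powRN_cvg _ 0 qs (lexx 0)) (limit_theta u u0 s s0)).
near=> n; have m0 := evn_gt0 (R:=R) n.
rewrite -evn_factor// mulrAC [leRHS]mulrC; apply: ler_wpM2l; first exact: powR_ge0.
by apply: H => //; rewrite divr_gt0.
Unshelve. all: by end_near. Qed.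

Lemma theta_noninc_of_S :
  (forall m y z : R, 0 < m -> 0 < y -> y <= z ->
    y `^ m * S_sq m y <= z `^ m * S_sq m z) ->
  forall s s' : R, 0 < s -> s <= s' -> theta s' <= theta s.
Proof.
move=> H s s' s0 ss'; have s'0 := lt_le_trans s0 ss'.
apply: (ler_cvg_to (limit_theta u u0 s' s'0) (limit_theta u u0 s s0)).
near=> n; have m0 := evn_gt0 (R:=R) n.
rewrite -!mulrA; apply: ler_wpM2l; first exact: ltW.
apply: H => //; first by rewrite divr_gt0.
by apply: ler_wpM2l; [exact: ltW|rewrite lef_pV2].
Unshelve. all: by end_near. Qed.

Let continuous_powR_expR (m c x : R) : 0 < x -> {for x, continuous (fun s =>
  s `^ m * expR (- (c * s)))}.
Proof.
move=> x0; apply: cvgM; first exact: is_derive_continuous (is_derive1_powR _ x0).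
apply: continuous_comp; last exact: continuous_expR.
by apply: cvgN; apply: cvgM; [exact: cvg_cst|exact: cvg_id].
Qed.

Let continuous_powR_expR_theta (m c q x : R) : 0 < q -> 0 < x ->
  {for x, continuous (fun s => s `^ m * expR (- (c * s)) * theta (q * s))}.
Proof.
move=> q0 x0; apply: cvgM; first exact: continuous_powR_expR.
apply: (@continuous_comp _ _ _ (fun s => q * s) theta).
  by apply: cvgM; [exact: cvg_cst|exact: cvg_id].
by apply: theta_continuous => //; rewrite mulr_gt0.
Qed.

Lemma S_le_of_theta (q : R) : (forall s : R, 0 < s ->
  theta s <= expR (- (q * s))) ->
  forall m y : R, 0 < m -> 0 <= y -> 0 < q + y -> m * S_sq m y <= (q + y) `^ (- m).
Proof.
move=> H m y m0 y0 qy; have [G G0 [H1 H2]] := theta_gamma u u0 m m0.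
have := H1 _ qy; have := H2 y 1 y0 ltr01.
rewrite powR1 mul1r divr1 => E2 E1.
suff : ((G * S_sq m y)%:E <= (G / m * (q + y) `^ (- m))%:E)%E.
  rewrite lee_fin -mulrA (ler_pM2l G0) => h.
  by rewrite mulrC -ler_pdivlMr// mulrC.
rewrite -E1 -E2; apply: ge0_le_int_0y.
- by move=> x x0; rewrite !mulr_ge0 ?powR_ge0 ?expR_ge0 ?theta_ge0 ?mul1r.
- by move=> x x0; exact: continuous_powR_expR_theta.
- by move=> x x0; exact: continuous_powR_expR.
- move=> x x0; rewrite mul1r -mulrA; apply: ler_wpM2l; first exact: powR_ge0.
  rewrite mulrDl opprD expRD mulrC; apply: ler_wpM2r; first exact: expR_ge0.
  exact: H.
Qed.

Lemma S_ge_of_theta (q : R) : (forall s : R, 0 < s ->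
  expR (- (q * s)) <= theta s) ->
  forall m y : R, 0 < m -> 0 <= y -> 0 < q + y -> (q + y) `^ (- m) <= m * S_sq m y.
Proof.
move=> H m y m0 y0 qy; have [G G0 [H1 H2]] := theta_gamma u u0 m m0.
have := H1 _ qy; have := H2 y 1 y0 ltr01.
rewrite powR1 mul1r divr1 => E2 E1.
suff : ((G / m * (q + y) `^ (- m))%:E <= (G * S_sq m y)%:E)%E.
  rewrite lee_fin -mulrA (ler_pM2l G0) => h.
  by rewrite mulrC -ler_pdivrMr// mulrC.
rewrite -E1 -E2; apply: ge0_le_int_0y.
- by move=> x x0; rewrite !mulr_ge0 ?powR_ge0 ?expR_ge0.
- by move=> x x0; exact: continuous_powR_expR.
- by move=> x x0; exact: continuous_powR_expR_theta.
- move=> x x0; rewrite mul1r -[leRHS]mulrA; apply: ler_wpM2l; first exact: powR_ge0.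
  rewrite mulrDl opprD expRD mulrC; apply: ler_wpM2l; first exact: expR_ge0.
  exact: H.
Qed.

Lemma S_nondec_of_theta :
  (forall s s' : R, 0 < s -> s <= s' -> theta s' <= theta s) ->
  forall m y z : R, 0 < m -> 0 < y -> y <= z ->
    y `^ m * S_sq m y <= z `^ m * S_sq m z.
Proof.
move=> H m y z m0 y0 yz; have z0 := lt_le_trans y0 yz.
have [G G0 [_ H2]] := theta_gamma u u0 m m0.
have yV : 0 < y^-1 by rewrite invr_gt0.
have zV : 0 < z^-1 by rewrite invr_gt0.
have E (x : R) : 0 < x -> x^-1 `^ (- m) = x `^ m.
  by move=> x0; rewrite -powR_inv1 ?(ltW x0)// -powRrM mulN1r opprK.
have Ey := H2 1 _ ler01 yV; rewrite (E y y0) invrK mul1r in Ey.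
have Ez := H2 1 _ ler01 zV; rewrite (E z z0) invrK mul1r in Ez.
rewrite -(ler_pM2l G0) -lee_fin -[X in (X <= _)%E]Ey -[X in (_ <= X)%E]Ez.
apply: ge0_le_int_0y.
- by move=> x x0; rewrite !mulr_ge0 ?powR_ge0 ?expR_ge0 ?theta_ge0// mulr_gt0.
- by move=> x x0; exact: continuous_powR_expR_theta.
- by move=> x x0; exact: continuous_powR_expR_theta.
- move=> x x0; apply: ler_wpM2l; first by rewrite mulr_ge0 ?powR_ge0 ?expR_ge0.
  apply: H; first by rewrite mulr_gt0.
  by apply: ler_wpM2r; [exact: ltW|rewrite lef_pV2].
Qed.

Let powRN_anti (r x y : R) : 0 < r -> 0 < x -> x <= y -> y `^ (- r) <= x `^ (- r).
Proof.
move=> r0 x0 xy; rewrite !powRN lef_pV2 ?posrE ?powR_gt0 ?(lt_le_trans x0)//.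
by apply: ge0_ler_powR; rewrite ?nnegrE; lra.
Qed.

Let powRNK (r x : R) : 0 < r -> 0 < x -> (x `^ (- r^-1)) `^ (- r) = x.
Proof.
by move=> r0 x0; rewrite -powRrM mulrNN mulVf ?powRr1 ?(ltW x0)// gt_eqF.
Qed.

Let powRNK' (r x : R) : 0 < r -> 0 < x -> (x `^ (- r)) `^ (- r^-1) = x.
Proof.
by move=> r0 x0; rewrite -powRrM mulrNN mulfV ?powRr1 ?(ltW x0)// gt_eqF.
Qed.

Lemma f_mu_ge (m t q : R) : 0 < m -> 0 < q + t ^+ 2 ->
  q <= f_mu m u t <-> m * S_sq m (t ^+ 2) <= (q + t ^+ 2) `^ (- m).
Proof.
move=> m0 qt; rewrite /f_mu S_muE lerBrDr.
have A0 : 0 < m * S_sq m (t ^+ 2) by rewrite mulr_gt0// S_sq_gt0// sqr_ge0.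
have mV : 0 < m^-1 by rewrite invr_gt0.
split => H.
- by rewrite -[leLHS](powRNK _ _ m0 A0); exact: powRN_anti.
- by rewrite -[leLHS](powRNK' _ _ m0 qt); exact: powRN_anti.
Qed.

Lemma f_mu_le (m t q : R) : 0 < m -> 0 < q + t ^+ 2 ->
  f_mu m u t <= q <-> (q + t ^+ 2) `^ (- m) <= m * S_sq m (t ^+ 2).
Proof.
move=> m0 qt; rewrite /f_mu S_muE lerBlDr.
have A0 : 0 < m * S_sq m (t ^+ 2) by rewrite mulr_gt0// S_sq_gt0// sqr_ge0.
have mV : 0 < m^-1 by rewrite invr_gt0.
split => H.
- by rewrite -[leRHS](powRNK _ _ m0 A0); apply: powRN_anti => //; exact: powR_gt0.
- by rewrite -[leRHS](powRNK' _ _ m0 qt); apply: powRN_anti => //; exact: powR_gt0.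
Qed.

Lemma m_infty_geP (x : \bar R) : (x <= m_infty u)%E <->
  forall m t : R, 0 < m -> 0 <= t -> (x <= (f_mu m u t)%:E)%E.
Proof.
split => [/ereal_infP H m t m0 t0|H].
  have /ereal_infP : (x <= m_mu m u)%E by apply: H; exists m.
  by apply; exists t.
apply/ereal_infP => _ [m /= m0 <-]; apply/ereal_infP => _ [t /= t0 <-].
exact: H.
Qed.

Lemma M_infty_leP (x : \bar R) : (M_infty u <= x)%E <->
  forall m t : R, 0 < m -> 0 <= t -> ((f_mu m u t)%:E <= x)%E.
Proof.
split => [/ereal_supP H m t m0 t0|H].
  have /ereal_supP : (M_mu m u <= x)%E by apply: H; exists m.
  by apply; exists t.
apply/ereal_supP => _ [m /= m0 <-]; apply/ereal_supP => _ [t /= t0 <-].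
exact: H.
Qed.

(** At q = t = 0 the base q + t^2 is 0, outside the range of f_mu_le; there
    f_mu is a power, hence nonnegative. *)
Lemma m_infty_ge_of_theta (q : R) : 0 <= q ->
  (forall s : R, 0 < s -> theta s <= expR (- (q * s))) -> (q%:E <= m_infty u)%E.
Proof.
move=> q0 H; apply/m_infty_geP => m t m0 t0; rewrite lee_fin.
have qt : 0 <= q + t ^+ 2 by rewrite addr_ge0// sqr_ge0.
move: qt; rewrite le_eqVlt => /predU1P[/esym/eqP|qt].
  rewrite paddr_eq0 ?sqr_ge0// sqrf_eq0 => /andP[/eqP -> /eqP ->].
  by rewrite /f_mu expr0n subr0 powR_ge0.
by apply/f_mu_ge => //; apply: S_le_of_theta => //; exact: sqr_ge0.
Qed.

Lemma m_infty_ge0 : (0 <= m_infty u)%E.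
Proof.
apply: m_infty_ge_of_theta => // s s0.
by rewrite mul0r oppr0 expR0 theta_le1.
Qed.

Lemma le_sqrt_m_infty (p : R) : 0 <= p -> (p%:E <= sqrte (m_infty u))%E <->
  forall s : R, 0 < s -> theta s <= expR (- (p ^+ 2 * s)).
Proof.
move=> p0.
have -> : p%:E = sqrte (p ^+ 2)%:E by rewrite /= sqrtr_sqr ger0_norm.
rewrite lee_sqrt ?m_infty_ge0//; split => [H|H]; last first.
  by apply: m_infty_ge_of_theta => //; exact: sqr_ge0.
apply: theta_le_of_S; first exact: sqr_ge0.
move=> m y m0 y0; rewrite -[y](sqr_sqrtr (ltW y0)).
apply/f_mu_ge => //.
  by rewrite sqr_sqrtr ?(ltW y0)// ltr_wpDl// sqr_ge0.
by rewrite -lee_fin; move/m_infty_geP : H; apply => //; exact: sqrtr_ge0.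
Qed.

(** By theta_decay, exp(d s) would grow at most linearly in s, where d is the
    gap (u+1)^2 - q. *)
Lemma theta_ge_exp_necessary (q : R) :
  (forall s : R, 1 <= s -> expR (- (q * s)) <= theta s) -> (u + 1) ^+ 2 <= q.
Proof.
move=> H; rewrite leNgt; apply/negP => qu.
set c := (u + 1) ^+ 2 in qu.
have [d dE] : exists d, d = c - q by exists (c - q).
have d0 : 0 < d by rewrite dE subr_gt0.
pose K := expR c * theta 1.
have K0 : 0 <= K by rewrite mulr_ge0 ?expR_ge0 ?theta_ge0.
(* Here exp (d s) >= (d s)^2 / 2 exceeds the linear bound s K, since d^2 s > 2 K. *)
pose s := 1 + 2 * (K + 1) / d ^+ 2.
have s1 : 1 <= s by rewrite lerDl divr_ge0 ?sqr_ge0// mulr_ge0// addr_ge0.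
have s0 : 0 < s by exact: lt_le_trans s1.
have h1 : expR (d * s) <= s * K.
  have := le_trans (H s s1) (theta_decay u u0 s s1).
  move=> /(ler_wpM2l (expR_ge0 (c * s))).
  rewrite -expRD.
  have -> : c * s + - (q * s) = d * s by rewrite dE; ring.
  rewrite /K -/c.
  have -> : expR (c * s) * (s * expR (- (c * (s - 1))) * theta 1) =
     s * ((expR (c * s) * expR (- (c * (s - 1)))) * theta 1) by ring.
  rewrite -expRD.
  by have -> : c * s + - (c * (s - 1)) = c by ring.
have h2 := @expR_ge1Dxn R (d * s) 1 (mulr_ge0 (ltW d0) (ltW s0)).
have h3 : (d * s) ^+ 2 / 2 <= s * K.
  apply: le_trans h1; apply: le_trans h2.
  by rewrite lerDr.
have h4 : d ^+ 2 * s / 2 <= K.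
  rewrite -(ler_pM2l s0); apply: le_trans h3.
  by rewrite le_eqVlt; apply/orP; left; apply/eqP; field.
have h5 : d ^+ 2 * s = d ^+ 2 + 2 * (K + 1) by rewrite /s; field; rewrite gt_eqF.
move: h4; rewrite h5 ler_pdivrMr//.
by have := exprn_gt0 2 d0; lra.
Qed.

(** The upper bound is theta_ge transported to the S_mu.  Conversely a bound
    on all f_mu transports back to theta, where theta_ge_exp_necessary applies. *)
Lemma M_inftyE : M_infty u = ((u + 1) ^+ 2)%:E.
Proof.
have up : (M_infty u <= ((u + 1) ^+ 2)%:E)%E.
  apply/M_infty_leP => m t m0 t0; rewrite lee_fin.
  have u1 : 0 < (u + 1) ^+ 2 by rewrite exprn_gt0// ltr_wpDl.
  have ut : 0 < (u + 1) ^+ 2 + t ^+ 2 by rewrite ltr_pwDl// sqr_ge0.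
  apply/f_mu_le => //; apply: S_ge_of_theta => //; last exact: sqr_ge0.
  by move=> s s0; exact: theta_ge.
apply/eqP; rewrite eq_le up/=.
have lo : forall m t : R, 0 < m -> 0 <= t -> ((f_mu m u t)%:E <= M_infty u)%E.
  by apply/M_infty_leP.
move: up lo; case: (M_infty u) => [r||] //=; last first.
  by move=> _ /(_ 1 0 ltr01 (lexx 0)).
move=> _ lo; rewrite lee_fin.
(* A bound r < 0 is replaced by 0, as the transfer to theta needs a nonnegative
   exponent. *)
have q0 : 0 <= Num.max r 0 by rewrite le_max lexx orbT.
have : (u + 1) ^+ 2 <= Num.max r 0.
  apply: theta_ge_exp_necessary => s s1.
  apply: theta_ge_of_S => //; last exact: lt_le_trans s1.
  move=> m y m0 y0; rewrite -[y](sqr_sqrtr (ltW y0)).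
  apply/f_mu_le => //.
    by rewrite sqr_sqrtr ?(ltW y0)// ltr_wpDl.
  rewrite le_max; apply/orP; left; rewrite -lee_fin.
  by apply: lo => //; exact: sqrtr_ge0.
rewrite le_max => /orP[//|].
by rewrite leNgt exprn_gt0// ltr_wpDl.
Qed.

Lemma sqrt_M_inftyE : sqrte (M_infty u) = (u + 1)%:E.
Proof. by rewrite M_inftyE /= sqrtr_sqr ger0_norm// addr_ge0. Qed.

Lemma is_derive_ge0 (F : R -> R) (t d : R) : is_derive t 1 F d ->
  (forall z : R, t < z -> F t <= F z) -> 0 <= d.
Proof.
move=> /is_derive1_caratheodory[k [kE kc <-]] H.
have c : k z @[z --> t^'+] --> k t by exact: cvg_at_right_filter.
apply: (cvgr_to_ge c); near=> z.
have tz : t < z by near: z; exact: nbhs_right_gt.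
have := H z tz; rewrite -subr_ge0 kE pmulr_lge0//.
by rewrite subr_gt0.
Unshelve. all: by end_near. Qed.

(** As the functions t^(2 mu) S_mu(t, u) are differentiable, the sign of their
    derivatives is their monotonicity. *)
Lemma derive_S_ge0P :
  (forall m t : R, 0 < m -> 0 < t ->
     0 <= derive1 (fun s : R => s `^ (2 * m) * S_mu m s u) t) <->
  (forall s s' : R, 0 < s -> s <= s' -> theta s' <= theta s).
Proof.
pose F m (s : R) := s `^ (2 * m) * S_mu m s u.
have FE m t : 0 < t -> F m t = (t ^+ 2) `^ m * S_sq m (t ^+ 2).
  move=> t0; rewrite /F S_muE; congr (_ * _).
  by rewrite powRrM -powR_mulrn// ltW.
have dF (m t : R) : 0 < m -> 0 < t -> is_derive t 1 (F m) (derive1 (F m) t).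
  move=> m0 t0; rewrite derive1E; apply: derivableP.
  have t2 : 0 < t ^+ 2 by rewrite exprn_gt0.
  have d1 := is_derive_S_sq u u0 m _ m0 t2.
  have d2 : is_derive t 1 (fun s : R => s ^+ 2) (2 * t).
    by apply: is_derive_eq; rewrite /= /GRing.scale/=; ring.
  have d3 : is_derive t 1 (fun s : R => S_sq m (s ^+ 2))
      (- ((m + 1) * S_sq (m + 1) (t ^+ 2)) * (2 * t)).
    exact: (@is_derive1_comp _ (S_sq m) (fun s : R => s ^+ 2)).
  have d4 := is_derive1_powR (2 * m) t0.
  apply: derivableM; first exact: ex_derive.
  by have := @ex_derive _ _ _ _ _ _ _ d3.
split => [H|H].
- apply: theta_noninc_of_S => m y z m0 y0 yz.
  have z0 := lt_le_trans y0 yz.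
  have FsqrtE x : 0 < x -> F m (Num.sqrt x) = x `^ m * S_sq m x.
    move=> x0; rewrite (FE m (Num.sqrt x)); last by rewrite sqrtr_gt0.
    by rewrite (sqr_sqrtr (ltW x0)).
  have sy0 : 0 < Num.sqrt y by rewrite sqrtr_gt0.
  rewrite -(FsqrtE y y0) -(FsqrtE z z0).
  apply: (@ge0_derive_le _ (F m) (derive1 (F m))).
  + exact: ler_wsqrtr.
  + by move=> x /andP[yx _]; apply: dF => //; exact: lt_le_trans yx.
  + by move=> x /andP[yx _]; apply: H => //; exact: lt_le_trans yx.
- move=> m t m0 t0; apply: is_derive_ge0 (dF m t m0 t0) _ => z tz.
  have z0 := lt_trans t0 tz.
  rewrite (FE m z z0) (FE m t t0); apply: S_nondec_of_theta => //;
    first by rewrite exprn_gt0.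
  by rewrite ler_sqr ?nnegrE; exact: ltW.
Qed.

End Links.

(** * Radial positive definite functions *)

Section PositiveDefinite.
Context {R : realType}.

Definition psd (I : finType) (A : I -> I -> R) : Prop :=
  forall c : I -> R, 0 <= \sum_i \sum_j c i * c j * A i j.

Definition sqdist (I J : finType) (x : I -> J -> R) (i j : I) : R :=
  \sum_l (x i l - x j l) ^+ 2.

(** Points are indexed by arbitrary finite types, and so are coordinates: this
    makes room for one more coordinate or for a second copy of the points, and
    quantifies over all dimensions at once.  The argument of G is the squared
    distance. *)
Definition radial_pd (G : R -> R) : Prop :=
  forall (I J : finType) (x : I -> J -> R), (0 < #|J|)%N ->
    psd I (fun i j => G (sqdist I J x i j)).

Lemma sqdistC (I J : finType) (x : I -> J -> R) i j :
  sqdist I J x i j = sqdist I J x j i.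
Proof. by apply: eq_bigr => l _; rewrite -sqrrN opprB. Qed.

Lemma sqdist_ge0 (I J : finType) (x : I -> J -> R) i j : 0 <= sqdist I J x i j.
Proof. by apply: sumr_ge0 => l _; exact: sqr_ge0. Qed.

(** The terms with real part times imaginary part cancel by symmetry, so that
    positive definiteness with complex coefficients reduces to real ones. *)
Lemma complex_form_real (n : nat) (A : 'I_n -> 'I_n -> R) (c : 'I_n -> R[i]) :
  (forall i j, A i j = A j i) ->
  \sum_(k < n) \sum_(j < n) c k * (c j)^* * (A k j)%:C%C =
  (\sum_(k < n) \sum_(j < n) complex.Re (c k) * complex.Re (c j) * A k j +
   \sum_(k < n) \sum_(j < n) complex.Im (c k) * complex.Im (c j) * A k j)%:C%C.
Proof.
move=> As.
pose a k := complex.Re (c k); pose b k := complex.Im (c k).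
have E k j : c k * (c j)^* * (A k j)%:C%C =
   (a k * a j * A k j + b k * b j * A k j)%:C%C +
   'i%C * ((b k * a j * A k j)%:C%C - (b j * a k * A j k)%:C%C).
  rewrite (As j k) /a /b; case: (c k) => [a1 b1]; case: (c j) => [a2 b2].
  by apply/eqP; rewrite eq_complex /=; apply/andP; split; apply/eqP; ring.
under eq_bigr do under eq_bigr do rewrite E.
under eq_bigr do rewrite big_split /= -mulr_sumr sumrB.
rewrite big_split /= -mulr_sumr sumrB.
rewrite [X in _ + _ * (_ - X)]exchange_big /= subrr mulr0 addr0.
rewrite -big_split /= rmorph_sum /=; apply: eq_bigr => k _.
by rewrite -big_split /= rmorph_sum.
Qed.

Lemma norm2E (d : nat) (I : finType) (x : I -> 'rV[R]_d) i j :
  norm2 (x i - x j) = Num.sqrt (sqdist I 'I_d (fun i l => x i ord0 l) i j).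
Proof. by congr Num.sqrt; apply: eq_bigr => l _; rewrite !mxE. Qed.

Lemma Phi_radial_pd (phi : R -> R) : Phi phi -> radial_pd (fun s =>
  phi (Num.sqrt s)).
Proof.
move=> H I J x J0 c.
have [_ P] := H #|J| J0.
pose y (k : 'I_#|I|) : 'rV[R]_#|J| := \row_l x (enum_val k) (enum_val l).
have := P #|I| y (fun k => (c (enum_val k))%:C%C).
have S (k j : 'I_#|I|) : norm2 (y k - y j) =
    Num.sqrt (sqdist I J x (enum_val k) (enum_val j)).
  rewrite norm2E; congr Num.sqrt.
  rewrite /sqdist [RHS](eq_bigl (fun l => l \in J))//.
  by rewrite [RHS]big_enum_val; apply: eq_bigr => l _; rewrite !mxE.
under eq_bigr do under eq_bigr do rewrite S.
rewrite (complex_form_real #|I| (fun k j =>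
  phi (Num.sqrt (sqdist I J x (enum_val k) (enum_val j)))) (fun k =>
  (c (enum_val k))%:C%C)); last first.
  by move=> i j; rewrite sqdistC.
rewrite /= [X in _ + X]big1; last by move=> k _; rewrite big1// => j _;
  rewrite !mul0r.
rewrite addr0 ler0c; congr (0 <= _).
rewrite [RHS](eq_bigl (fun l => l \in I))// [RHS]big_enum_val;
  apply: eq_bigr => k _.
by rewrite [RHS](eq_bigl (fun l => l \in I))// [RHS]big_enum_val.
Qed.

Lemma radial_pd_Phi (phi : R -> R) : {within `[0, +oo[, continuous phi} ->
  radial_pd (fun s => phi (Num.sqrt s)) -> Phi phi.
Proof.
move=> cphi H d d0; split => // n x c.
under eq_bigr do under eq_bigr do rewrite norm2E.
rewrite (complex_form_real n (fun k j =>
  phi (Num.sqrt (sqdist 'I_n 'I_d (fun i l => x i ord0 l) k j))) c); last first.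
  by move=> i j; rewrite sqdistC.
by rewrite ler0c addr_ge0//; apply: H; rewrite card_ord.
Qed.

Lemma cvg_sum_fin (T : Type) (F : set_system T) {FF : Filter F} (I : finType)
    (f : I -> T -> R) (l : I -> R) :
  (forall i, f i t @[t --> F] --> l i) ->
  \sum_i f i t @[t --> F] --> \sum_i l i.
Proof.
move=> fl; rewrite -big_enum /=.
rewrite (_ : (fun t => _) = (fun t => \sum_(i <- enum I) f i t)); last first.
  by apply/funext => t; rewrite big_enum.
elim: (enum I) => [|i s IH].
  by rewrite big_nil; under eq_fun do rewrite big_nil; exact: cvg_cst.
by rewrite big_cons; under eq_fun do rewrite big_cons; exact: cvgD.
Qed.

Lemma psd_cvg (T : Type) (F : set_system T) {FF : ProperFilter F} (I : finType)
    (A : T -> I -> I -> R) (B : I -> I -> R) :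
  (\forall t \near F, psd I (A t)) ->
  (forall i j, A t i j @[t --> F] --> B i j) -> psd I B.
Proof.
move=> HA AB c.
have H : \sum_i \sum_j c i * c j * A t i j @[t --> F] --> \sum_i \sum_j c i * c j
  * B i j.
  apply: cvg_sum_fin => i; apply: cvg_sum_fin => j.
  by apply: cvgM; [exact: cvg_cst|exact: AB].
by apply: (cvgr_to_ge H); apply: filterS HA => t; exact.
Qed.

(** Gram matrices are closed under entrywise products, with products of
    features, which gives the Schur product theorem where it is needed. *)
Definition gram (I : finType) (A : I -> I -> R) : Prop :=
  exists (T : finType) (v : T -> I -> R), forall i j, A i j = \sum_t v t i * v t j.

Lemma gram_psd (I : finType) (A : I -> I -> R) : gram I A -> psd I A.
Proof.
move=> [T [v Av]] c.
have -> : \sum_i \sum_j c i * c j * A i j = \sum_t (\sum_i c i * v t i) ^+ 2.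
  under eq_bigr do under eq_bigr do rewrite Av mulr_sumr.
  under eq_bigr do rewrite exchange_big.
  rewrite exchange_big; apply: eq_bigr => t _.
  rewrite expr2 mulr_suml; apply: eq_bigr => i _.
  by rewrite mulr_sumr; apply: eq_bigr => j _; ring.
by apply: sumr_ge0 => t _; exact: sqr_ge0.
Qed.

Lemma gramM (I : finType) (A B : I -> I -> R) : gram I A -> gram I B ->
  gram I (fun i j => A i j * B i j).
Proof.
move=> [T [v Av]] [S [w Bw]].
exists (prod T S : finType), (fun p i => v p.1 i * w p.2 i) => i j.
rewrite Av Bw big_distrlr /= pair_bigA; apply: eq_bigr => p _ /=; ring.
Qed.

Lemma gramX (I : finType) (A : I -> I -> R) n : gram I A ->
  gram I (fun i j => A i j ^+ n).
Proof.
move=> gA; elim: n => [|n IH].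
  exists (unit : finType), (fun _ _ => 1) => i j.
  by rewrite sumr_const card_unit expr0 mulr1.
have [T [v E]] := gramM I _ _ gA IH.
by exists T, v => i j; rewrite exprS E.
Qed.

(** exp(- tau |x - y|^2) is exp(- tau |x|^2) exp(- tau |y|^2) exp(2 tau <x, y>),
    and the last factor is a power series in the Gram matrix with nonnegative
    coefficients. *)
Lemma gauss_psd (I J : finType) (x : I -> J -> R) (tau : R) : 0 <= tau ->
  psd I (fun i j => expR (- (tau * sqdist I J x i j))).
Proof.
move=> tau0.
pose B i j := \sum_l x i l * x j l.
pose w i := expR (- (tau * B i i)).
have E i j : expR (- (tau * sqdist I J x i j)) = w i * w j * expR (2 * tau * B i j).
  rewrite /w -!expRD; congr expR.
  rewrite /sqdist [X in tau * X](_ : _ = B i i + B j j - 2 * B i j); first by ring.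
  rewrite /B -big_split /= mulr_sumr -sumrB; apply: eq_bigr => l _; ring.
have gB : gram I B by exists J, (fun l i => x i l).
have P : psd I (fun i j => expR (2 * tau * B i j)).
  apply: (@psd_cvg nat \oo _ I (fun n i j =>
    series (exp_coeff (2 * tau * B i j)) n)).
    near=> n; move=> c.
    have -> : \sum_i \sum_j c i * c j * series (exp_coeff (2 * tau * B i j)) n =
       \sum_(0 <= k < n) ((2 * tau) ^+ k / k`!%:R * \sum_i \sum_j c i * c j * B i
         j ^+ k).
      rewrite /series /=.
      under eq_bigr do under eq_bigr do rewrite mulr_sumr.
      under eq_bigr do rewrite exchange_big.
      rewrite exchange_big /=; apply: eq_bigr => k _.
      rewrite mulr_sumr; apply: eq_bigr => i _; rewrite mulr_sumr;
        apply: eq_bigr => j _.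
      by rewrite /exp_coeff /= exprMn; ring.
    apply: sumr_ge0 => k _; apply: mulr_ge0.
      by rewrite divr_ge0 ?exprn_ge0// mulr_ge0.
    exact: (gram_psd I _ (gramX I B k gB)).
  by move=> i j; exact: is_cvg_series_exp_coeff.
move=> c; have := P (fun i => c i * w i); congr (0 <= _).
apply: eq_bigr => i _; apply: eq_bigr => j _; rewrite E; ring.
Unshelve. all: by end_near. Qed.

Definition decr (h : R) (G : R -> R) (s : R) : R := G s - G (s + h).

(** Take each point twice, with opposite coefficients, the two copies being
    separated by sqrt h in a new orthogonal direction.  So the
    dimension grows by one. *)
Lemma decr_radial_pd (h : R) (G : R -> R) : 0 <= h -> radial_pd G ->
  radial_pd (decr h G).
Proof.
move=> h0 HG I J x J0 c.
pose y (p : bool * I) (l : unit + J) : R :=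
  match l with inl _ => if p.1 then Num.sqrt h else 0 | inr l => x p.2 l end.
pose cc (p : bool * I) : R := if p.1 then - c p.2 else c p.2.
have J1 : (0 < #|{: unit + J}|)%N by rewrite card_sum card_unit.
have := HG (prod bool I : finType) (sum unit J : finType) y J1 cc.
have D b b' i j : sqdist (prod bool I : finType) (sum unit J : finType) y (b, i)
  (b', j) =
   sqdist I J x i j + (if b == b' then 0 else h).
  rewrite /sqdist big_sumType /= addrC; congr (_ + _).
  rewrite big_const card_unit /= addr0.
  by case: b b' => [] [] /=; rewrite ?subrr ?expr0n//= ?subr0 ?sub0r ?sqrrN
    sqr_sqrtr.
rewrite -(pair_bigA _ (fun b i =>
  \sum_j cc (b, i) * cc j * G (sqdist _ _ y (b, i) j))) /=.
under eq_bigr do under eq_bigr do rewrite -(pair_bigA _ (fun b' j =>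
  cc (_, _) * cc (b', j) * G (sqdist _ _ y (_, _) (b', j)))) /=.
rewrite big_bool /=.
under [X in X + _]eq_bigr do rewrite big_bool /=.
under [X in _ + X]eq_bigr do rewrite big_bool /=.
under [X in X + _]eq_bigr do under eq_bigr do rewrite D /cc /= addr0.
under [X in X + _]eq_bigr do under [X in _ + X]eq_bigr do rewrite D /cc /=.
under [X in _ + X]eq_bigr do under eq_bigr do rewrite D /cc /=.
under [X in _ + X]eq_bigr do under [X in _ + X]eq_bigr do rewrite D /cc /= addr0.
rewrite -big_split /=.
have -> : \sum_i (\sum_j - c i * - c j * G (sqdist I J x i j) +
    \sum_j - c i * c j * G (sqdist I J x i j + h) +
    (\sum_j c i * - c j * G (sqdist I J x i j + h) +
    \sum_j c i * c j * G (sqdist I J x i j))) =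
  2 * \sum_i \sum_j c i * c j * decr h G (sqdist I J x i j).
  rewrite mulr_sumr; apply: eq_bigr => i _.
  rewrite -!big_split /= mulr_sumr; apply: eq_bigr => j _.
  by rewrite /decr; ring.
by rewrite pmulr_rge0.
Qed.

(** N + 1 points at mutual squared distance t, all coefficients being 1, give
    G(0) + N G(t) >= 0 for every N. *)
Lemma radial_pd_ge0 (G : R -> R) (t : R) : radial_pd G -> 0 < t -> 0 <= G t.
Proof.
move=> HG t0; rewrite leNgt; apply/negP => Gt.
have K N : 0 <= G 0 + N%:R * G t.
  pose x (i j : 'I_N.+1) : R := if i == j then Num.sqrt (t / 2) else 0.
  have t2 : 0 <= t / 2 by rewrite divr_ge0// ltW.
  have Dii i : sqdist 'I_N.+1 'I_N.+1 x i i = 0.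
    by rewrite /sqdist big1// => l _; rewrite subrr expr0n.
  have Dij i j : j != i -> sqdist 'I_N.+1 'I_N.+1 x i j = t.
    move=> ij; rewrite /sqdist (bigD1 i)//= (bigD1 j)//= big1.
      rewrite /x !eqxx (negbTE ij) eq_sym (negbTE ij) subr0 sub0r sqrrN sqr_sqrtr//.
      by rewrite addr0; field.
    by move=> l /andP[li lj]; rewrite /x eq_sym (negbTE li) eq_sym (negbTE lj)
      subrr expr0n.
  have := HG 'I_N.+1 'I_N.+1 x _ (fun=> 1); rewrite card_ord => /(_ isT).
  have -> : \sum_i \sum_j 1 * 1 * G (sqdist 'I_N.+1 'I_N.+1 x i j) =
     N.+1%:R * (G 0 + N%:R * G t).
    transitivity (\sum_(i < N.+1) (G 0 + N%:R * G t)).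
      apply: eq_bigr => i _; rewrite (bigD1 i)//= Dii !mul1r; congr (_ + _).
      transitivity (\sum_(j < N.+1 | j != i) G t).
        by apply: eq_bigr => j ij; rewrite !mul1r Dij.
      rewrite sumr_const cardC1 card_ord /= mulr_natl//.
    by rewrite sumr_const card_ord [RHS]mulr_natl.
  by rewrite pmulr_rge0.
have gt0 : 0 < - G t by rewrite oppr_gt0.
have [N] : exists N : nat, G 0 / (- G t) < N%:R.
  exists (Num.bound `|G 0 / (- G t)|).
  by apply: le_lt_trans (ler_norm _) _; apply: archi_boundP.
rewrite ltr_pdivrMr// mulrN => H.
by have := K N; lra.
Qed.

(** Complete monotonicity on ]0, +oo[, with differences in place of
    derivatives: these are what positive definiteness controls directly. *)
Definition completely_monotone (G : R -> R) : Prop := forall (n : nat) (t h : R),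
  0 < t -> 0 < h -> 0 <= iter n (decr h) G t.

Lemma radial_pd_completely_monotone (G : R -> R) : radial_pd G ->
  completely_monotone G.
Proof.
move=> HG n t h t0 h0; apply: radial_pd_ge0 => //.
by elim: n => //= n IH; apply: decr_radial_pd => //; exact: ltW.
Qed.

(** The integral representations below hold at positive squared distances,
    which leaves out the diagonal; the shift by e moves it away from 0. *)
Lemma radial_pd_shift_lim (G : R -> R) :
  (forall e : R, 0 < e -> radial_pd (fun s => G (s + e))) ->
  (forall s : R, 0 <= s -> G (s + e) @[e --> 0^'+] --> G s) -> radial_pd G.
Proof.
move=> H C I J x J0.
apply: (@psd_cvg R (0^'+) _ I (fun e i j => G (sqdist I J x i j + e))).
  near=> e; apply: H => //; near: e; exact: nbhs_right_gt.
by move=> i j; apply: C; exact: sqdist_ge0.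
Unshelve. all: by end_near. Qed.

End PositiveDefinite.

(** * Mixtures of Gaussians and the sign of the weight *)

Section KernelRepresentation.
Context {R : realType}.
Notation mu := (@lebesgue_measure R).
Notation Dpos := (`](0%R:R), +oo[%classic : set R).

Let mDpos : @measurable _ (measurableTypeR R) Dpos.
Proof. exact: measurable_itv. Qed.

(** G, a function of the squared radius, is the mixture with signed weight w. *)
Definition heat_rep (w G : R -> R) : Prop := forall t : R, 0 < t ->
  mu.-integrable Dpos (EFin \o (fun r => heat_ker (Num.sqrt t) r * w r)) /\
  (\int[mu]_(r in Dpos) (heat_ker (Num.sqrt t) r * w r))%R = G t.

Lemma heat_ker_sqrtD (t e r : R) : 0 <= t -> 0 <= e ->
  heat_ker (Num.sqrt (t + e)) r =
    heat_ker (Num.sqrt t) r * expR (- (e / (4 * r ^+ 2))).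
Proof.
move=> t0 e0; rewrite /heat_ker !sqr_sqrtr ?addr_ge0// mulrDl opprD expRD.
by rewrite mulrAC.
Qed.

(** A difference of step h multiplies exp(- t / (4 r^2)) by
    1 - exp(- h / (4 r^2)). *)
Lemma heat_rep_decr (w G : R -> R) (h : R) : 0 <= h -> heat_rep w G ->
  heat_rep (fun r => (1 - expR (- (h / (4 * r ^+ 2)))) * w r) (decr h G).
Proof.
move=> h0 H t t0; have [i1 E1] := H t t0.
have [i2 E2] := H (t + h) (ltr_wpDr h0 t0).
have E : (fun r => heat_ker (Num.sqrt t) r * ((1 - expR (- (h / (4 * r ^+ 2)))) *
  w r)) =
    (fun r => heat_ker (Num.sqrt t) r * w r - heat_ker (Num.sqrt (t + h)) r * w r).
  by apply/funext => r; rewrite heat_ker_sqrtD ?(ltW t0)//; ring.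
rewrite E; split.
  have := integrableB mDpos i1 i2.
  exact: eq_integrable.
by rewrite RintegralB// E1 E2.
Qed.

Lemma heat_rep_iter (w G : R -> R) (h : R) n : 0 <= h -> heat_rep w G ->
  heat_rep (fun r => (1 - expR (- (h / (4 * r ^+ 2)))) ^+ n * w r) (iter n (decr
    h) G).
Proof.
move=> h0 H; elim: n => [|n IH].
  by rewrite (_ : (fun r => _) = w)//; apply/funext => r; rewrite expr0 mul1r.
have := heat_rep_decr _ _ h h0 IH.
congr (heat_rep _ _); apply/funext => r; rewrite [_ ^+ n.+1]exprS; ring.
Qed.

Lemma Rintegral_sum (I : finType) (F : I -> R -> R) :
  (forall i, mu.-integrable Dpos (EFin \o F i)) ->
  mu.-integrable Dpos (EFin \o (fun r => \sum_i F i r)) /\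
  (\int[mu]_(r in Dpos) (\sum_i F i r))%R = \sum_i (\int[mu]_(r in Dpos) (F i r))%R.
Proof.
move=> iF.
have mD := mDpos.
rewrite -[X in _ /\ _ = X]big_enum /=.
rewrite (_ : (fun r => _) = (fun r => \sum_(i <- enum I) F i r)); last first.
  by apply/funext => t; rewrite big_enum.
elim: (enum I) => [|i s [IH1 IH2]].
  rewrite big_nil (_ : (fun r => _) = cst 0); last by apply/funext => r;
    rewrite big_nil.
  split; first exact: integrable0.
  by rewrite Rintegral_cst// mul0r.
rewrite big_cons (_ : (fun r => _) = (fun r => F i r + \sum_(i <- s) F i r));
  last first.
  by apply/funext => r; rewrite big_cons.
split.
  have := integrableD mD (iF i) IH1.
  exact: eq_integrable.
by rewrite RintegralD// IH2.
Qed.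

Lemma heat_rep_radial_pd (w G : R -> R) : heat_rep w G ->
  (forall r : R, 0 < r -> 0 <= w r) ->
  forall e : R, 0 < e -> radial_pd (fun s => G (s + e)).
Proof.
move=> H w0 e e0 I J x J0 c.
have mD := mDpos.
pose d i j := sqdist I J x i j.
have de i j : 0 < d i j + e by rewrite ltr_wpDl// sqdist_ge0.
pose F i j r := c i * c j * (heat_ker (Num.sqrt (d i j + e)) r * w r).
have iF i j : mu.-integrable Dpos (EFin \o F i j).
  have [i1 _] := H _ (de i j).
  have := integrableZl mD (c i * c j) i1.
  exact: eq_integrable.
have EF i j : (\int[mu]_(r in Dpos) (F i j r))%R = c i * c j * G (d i j + e).
  have [i1 E1] := H _ (de i j).
  by rewrite /F RintegralZl// E1.
under eq_bigr do under eq_bigr do rewrite -EF.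
under eq_bigr do rewrite -(proj2 (Rintegral_sum I _ (iF _))).
rewrite -(proj2 (Rintegral_sum I _ (fun i => proj1 (Rintegral_sum I _ (iF i))))).
apply: Rintegral_ge0 => r; rewrite /= in_itv/= andbT => r0.
have -> : \sum_i \sum_j F i j r = heat_ker (Num.sqrt e) r * w r *
    \sum_i \sum_j c i * c j * expR (- ((4 * r ^+ 2)^-1 * d i j)).
  rewrite mulr_sumr; apply: eq_bigr => i _; rewrite mulr_sumr;
    apply: eq_bigr => j _.
  by rewrite /F addrC heat_ker_sqrtD ?(ltW e0) ?sqdist_ge0// [d i j / _]mulrC; ring.
apply: mulr_ge0; first by rewrite mulr_ge0 ?heat_ker_ge0 ?w0.
by apply: gauss_psd; rewrite invr_ge0 mulr_ge0// sqr_ge0.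
Qed.

(** Suppose w(r0) < 0.  With y(r) = exp(- h / (4 r^2)), the j-th difference of
    step h at 1 + j h is the integral of (y (1 - y))^j against the integrable
    function p = heat_ker 1 w.  Here y (1 - y) = 1/4 - (y - 1/2)^2 has its maximum
    at r0 when y(r0) = 1/2, which fixes h.  So the contribution near r0, of
    order - B^j, beats the rest, of order A^j with A < B, although the integral
    is nonnegative for all j. *)
Lemma heat_rep_ge0 (w G : R -> R) : heat_rep w G -> completely_monotone G ->
  (forall r : R, 0 < r -> {for r, continuous w}) ->
  forall r : R, 0 < r -> 0 <= w r.
Proof.
move=> H HG cw r0 r00; rewrite leNgt; apply/negP => wr0.
have mD := mDpos.
(* The step for which y r0 = 1/2. *)
pose h : R := 4 * r0 ^+ 2 * ln 2.
have h0 : 0 < h by rewrite !mulr_gt0// ?exprn_gt0// ln_gt0// ltr1n.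
pose y (r : R) : R := expR (- (h / (4 * r ^+ 2))).
have yr0 : y r0 = 2^-1.
  rewrite /y /h (_ : _ / _ = ln 2); last by field; rewrite gt_eqF.
  by rewrite expRN lnK// posrE.
have ymono (a b : R) : 0 < a -> a < b -> y a < y b.
  move=> a0 ab; have b0 := lt_trans a0 ab.
  rewrite /y ltr_expR ltrN2 ltr_pM2l// ltf_pV2 ?posrE ?mulr_gt0 ?exprn_gt0//.
  by rewrite ltr_pM2l//; nra.
have y01 (r : R) : 0 <= y r <= 1.
  by rewrite expR_ge0/= expR_le1 oppr_le0 divr_ge0 ?(ltW h0)// mulr_ge0// sqr_ge0.
pose p (r : R) := heat_ker (Num.sqrt 1) r * w r.
have [ip _] := H 1 ltr01.
have cp : {for r0, continuous p}.
  by apply: cvgM; [exact: heat_ker_continuous|exact: cw].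
have pr0 : p r0 < 0.
  by rewrite /p nmulr_llt0// /heat_ker divr_gt0 ?expR_gt0// exprn_gt0.
pose eta := - p r0 / 2.
have eta0 : 0 < eta by rewrite divr_gt0// oppr_gt0.
have cy : {for r0, continuous y}.
  rewrite /y; apply: continuous_comp; last exact: continuous_expR.
  apply: cvgN; apply: cvgM; first exact: cvg_cst.
  apply: cvgV; first by rewrite mulf_neq0 ?sqrf_eq0 ?gt_eqF.
  by apply: cvgM; [exact: cvg_cst|exact: exprn_continuous].
have [d1 d10 Hd1] : exists2 d1 : R, 0 < d1 & forall r, `|r0 - r| < d1 ->
  p r <= - eta.
  have : \forall r \near r0, p r < - eta.
    by move: cp => /cvgr_lt; apply; rewrite /eta; lra.
  by case/nbhs_ballP => d1 /= d10 Hd; exists d1 => // r /Hd /ltW.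
(* p <= - eta on a neighbourhood of r0 of radius d2, and its closure stays in
   ]0, +oo[. *)
pose d2 := Num.min d1 r0 / 2.
have d20 : 0 < d2 by rewrite divr_gt0// lt_min d10.
have d2r : d2 < r0 by rewrite /d2 ltr_pdivrMr// gt_min; apply/orP; right; lra.
have d2d : d2 < d1 by rewrite /d2 ltr_pdivrMr// gt_min; apply/orP; left; lra.
pose d := Num.min (2^-1 - y (r0 - d2)) (y (r0 + d2) - 2^-1).
have dp : 0 < d by rewrite lt_min !subr_gt0 -yr0 !ymono//; lra.
have dle : d <= 2^-1.
  by rewrite ge_min lerBlDr lerDl (proj1 (andP (y01 _))).
have [d3 d30 Hd3] : exists2 d3 : R, 0 < d3 & forall r, `|r0 - r| < d3 ->
  `|y r - 2^-1| <= d / 2.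
  move/cvgrPdist_le : cy => /(_ (d / 2)); rewrite divr_gt0// => /(_ isT).
  case/nbhs_ballP => d3 /= d30 Hd; exists d3 => // r /Hd /=.
  by rewrite yr0 distrC.
pose d4 := Num.min d3 d2 / 2.
have d40 : 0 < d4 by rewrite divr_gt0// lt_min d30.
have d43 : d4 < d3 by rewrite /d4 ltr_pdivrMr// gt_min; apply/orP; left; lra.
have d42 : d4 < d2 by rewrite /d4 ltr_pdivrMr// gt_min; apply/orP; right; lra.
(* On the smaller interval V the values of y are within d / 2 of 1/2. *)
pose V : set R := `[r0 - d4, r0 + d4]%classic.
have VD : V `<=` Dpos.
  by move=> r; rewrite /V /= !in_itv/= andbT => /andP[+ _]; apply: lt_le_trans; lra.
pose k (r : R) := y r * (1 - y r).
have kE r : k r = 4^-1 - (y r - 2^-1) ^+ 2 by rewrite /k; field.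
pose A := 4^-1 - d ^+ 2.
pose B := 4^-1 - (d / 2) ^+ 2.
have k0 r : 0 <= k r by have /andP[? ?] := y01 r; rewrite mulr_ge0// subr_ge0.
have A0 : 0 <= A by rewrite /A; nra.
have AB : A < B by rewrite /A /B; nra.
have B0 : 0 < B by exact: le_lt_trans AB.
have out r : 0 < r -> d2 <= `|r0 - r| -> k r <= A.
  move=> rp; rewrite kE /A lerD2l lerN2 => Hr.
  suff : d <= `|y r - 2^-1|.
    by move=> dd; rewrite -[leRHS]real_normK ?num_real// ler_sqr ?nnegrE// ltW.
  have [rr|rr] := leP r r0.
  - have r' : r <= r0 - d2 by move: Hr; rewrite ger0_norm ?subr_ge0//; lra.
    have yy : y r <= y (r0 - d2).
      move: r'; rewrite le_eqVlt => /predU1P[->//|r']; exact/ltW/ymono.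
    have dd : d <= 2^-1 - y (r0 - d2) by rewrite ge_min lexx.
    by rewrite distrC (le_trans _ (ler_norm _))//; lra.
  - have r' : r0 + d2 <= r by move: Hr; rewrite distrC gtr0_norm ?subr_gt0//; lra.
    have yy : y (r0 + d2) <= y r.
      move: r'; rewrite le_eqVlt => /predU1P[->//|r']; apply/ltW/ymono => //; lra.
    have dd : d <= y (r0 + d2) - 2^-1 by rewrite ge_min lexx orbT.
    by rewrite (le_trans _ (ler_norm _))//; lra.
have inV r : V r -> B <= k r.
  rewrite /V /= in_itv/= => /andP[v1 v2].
  have vd : `|r0 - r| < d3.
    by apply: le_lt_trans d43; rewrite ler_norml; apply/andP; split; lra.
  rewrite kE /B lerD2l lerN2 -[leLHS]real_normK ?num_real//.
  by rewrite ler_sqr ?nnegrE ?Hd3// divr_ge0// ltW.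
have ptw j r : 0 < r -> k r ^+ j * p r <= A ^+ j * `|p r| - B ^+ j * eta * \1_V r.
  move=> rp.
  have [rV|rV] := pselect (V r).
    rewrite indicE mem_set// mulr1.
    have pe : p r <= - eta.
      apply: Hd1; move: rV; rewrite /V /= in_itv/= => /andP[v1 v2].
      apply: (@le_lt_trans _ _ d4); last by lra.
      by rewrite ler_norml; apply/andP; split; lra.
    have kb : B ^+ j <= k r ^+ j by apply: lerXn2r (inV _ rV); rewrite nnegrE// ltW.
    have Aj : 0 <= A ^+ j * `|p r| by rewrite mulr_ge0// exprn_ge0.
    have Bj : 0 < B ^+ j by rewrite exprn_gt0.
    by nra.
  rewrite indicE memNset// mulr0 subr0.
  have [rd|rd] := leP d2 `|r0 - r|.
    apply: (@le_trans _ _ (k r ^+ j * `|p r|)).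
      by apply: ler_wpM2l (ler_norm _); rewrite exprn_ge0.
    by apply: ler_wpM2r => //; apply: lerXn2r (out _ rp rd); rewrite nnegrE.
  have pe : p r <= 0 by apply: le_trans (Hd1 _ _) _; lra.
  apply: (@le_trans _ _ 0); first by rewrite mulr_ge0_le0// exprn_ge0.
  by rewrite mulr_ge0// exprn_ge0.
pose I := (\int[mu]_(r in Dpos) `|p r|)%R.
have mV : @measurable _ (measurableTypeR R) V by exact: measurable_itv.
have iV : mu.-integrable Dpos (EFin \o (\1_V : R -> R)).
  apply: (integrableS (measurableT : @measurable _ (measurableTypeR R) setT)
    mDpos (@subsetT _ _)); exact: integrable_indic_itv.
have EV : (\int[mu]_(r in Dpos) (\1_V r))%R = 2 * d4.
  have mVE : (mu `[(r0 - d4)%R, (r0 + d4)%R]%classic = (2 * d4)%:E)%E.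
    rewrite lebesgue_measure_itv/= lte_fin ifT; last lra.
    by rewrite -EFinB; congr EFin; ring.
  rewrite /Rintegral integral_indic//. rewrite (setIidl VD).
  by rewrite [X in fine X](_ : _ = (2 * d4)%:E%E).
have key j : B ^+ j * (eta * (2 * d4)) <= A ^+ j * I.
  have tj0 : 0 < 1 + j%:R * h by rewrite ltr_wpDr// mulr_ge0// ltW.
  have := HG j (1 + j%:R * h) h tj0 h0.
  have [i1 <-] := heat_rep_iter _ _ h j (ltW h0) H _ tj0.
  have E : (fun r => heat_ker (Num.sqrt (1 + j%:R * h)) r *
      ((1 - expR (- (h / (4 * r ^+ 2)))) ^+ j * w r)) = (fun r => k r ^+ j * p r).
    apply/funext => r; rewrite heat_ker_sqrtD//; last by rewrite mulr_ge0// ltW.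
    have -> : expR (- (j%:R * h / (4 * r ^+ 2))) = y r ^+ j.
      by rewrite /y -expRM_natl mulrN -[j%:R * h / _]mulrA.
    rewrite -/(y r) /k exprMn /p; ring.
  rewrite E in i1 *; move=> le0.
  have ia : mu.-integrable Dpos (EFin \o (fun r => A ^+ j * `|p r|)).
    have := integrableZl mD (A ^+ j) (integrable_norm ip).
    exact: eq_integrable.
  have ib : mu.-integrable Dpos (EFin \o (fun r => B ^+ j * eta * \1_V r)).
    have := integrableZl mD (B ^+ j * eta) iV.
    exact: eq_integrable.
  have iab : mu.-integrable Dpos (EFin \o (fun r =>
    A ^+ j * `|p r| - B ^+ j * eta * \1_V r)).
    have := integrableB mD ia ib.
    exact: eq_integrable.
  have : (\int[mu]_(r in Dpos) (k r ^+ j * p r))%R <=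
      (\int[mu]_(r in Dpos) (A ^+ j * `|p r| - B ^+ j * eta * \1_V r))%R.
    apply: le_Rintegral => // r; rewrite /= in_itv/= andbT; exact: ptw.
  move=> /(le_trans le0).
  rewrite RintegralB// RintegralZl//; last exact: integrable_norm.
  by rewrite RintegralZl// EV subr_ge0 -mulrA.
have c0 : 0 < eta * (2 * d4) by apply: mulr_gt0 => //; apply: mulr_gt0.
have cv : (A / B) ^+ j * I @[j --> \oo] --> 0 * I.
  apply: cvgM; last exact: cvg_cst.
  apply: cvg_expr; rewrite ger0_norm ?divr_ge0 ?(ltW B0)//.
  by rewrite ltr_pdivrMr// mul1r.
rewrite mul0r in cv.
have : eta * (2 * d4) <= 0.
  apply: (cvgr_to_ge cv); near=> j.
  rewrite expr_div_n [leRHS]mulrAC ler_pdivlMr ?exprn_gt0// [leLHS]mulrC.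
  exact: key.
by rewrite leNgt c0.
Unshelve. all: by end_near. Qed.

End KernelRepresentation.

(** * Membership in Phi and the sign of the weight *)

Section Schoenberg.
Context {R : realType}.
Notation mu := (@lebesgue_measure R).
Notation Dpos := (`](0%R:R), +oo[%classic : set R).

(** Continuity on [0, +oo[ in the form in which it is used on the diagonal,
    where s = 0. *)
Lemma continuous_sqrt_shift (phi : R -> R) (s : R) :
  {within `[0, +oo[, continuous phi} -> 0 <= s ->
  phi (Num.sqrt (s + e)) @[e --> 0^'+] --> phi (Num.sqrt s).
Proof.
move=> /continuous_within_itvcyP[cphi c0]; rewrite le_eqVlt => /predU1P[<-|s0].
  rewrite sqrtr0.
  apply: (@cvg_comp _ _ _ (fun e => Num.sqrt (0 + e)) phi _ (0^'+)); last exact: c0.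
  move=> A [d /= d0 dA]; exists (d ^+ 2); first by rewrite /= exprn_gt0.
  move=> z /=; rewrite sub0r normrN => zd z0.
  apply: dA => /=; last by rewrite add0r sqrtr_gt0.
  rewrite sub0r normrN add0r ger0_norm ?sqrtr_ge0//.
  rewrite -(@ger0_norm _ d) ?(ltW d0)// -sqrtr_sqr ltr_sqrt ?exprn_gt0//.
  by rewrite -(gtr0_norm z0).
apply: (@cvg_comp _ _ _ (fun e => Num.sqrt (s + e)) phi _ (nbhs (Num.sqrt s))).
  apply: cvg_at_right_filter.
  rewrite -[X in _ --> nbhs (Num.sqrt X)]addr0.
  apply: (continuous_comp (f := fun e => s + e) (g := Num.sqrt)).
    by apply: cvgD; [exact: cvg_cst|exact: cvg_id].
  exact: sqrt_continuous.
by apply: cphi; rewrite in_itv/= andbT sqrtr_gt0.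
Qed.

(** The direct half of the criterion: the mixture with a nonnegative weight is
    positive definite at squared distances shifted by e > 0, and the shift tends
    to 0 by continuity. *)
Lemma Phi_of_heat_rep (w phi : R -> R) : {within `[0, +oo[, continuous phi} ->
  heat_rep w (fun t => phi (Num.sqrt t)) ->
  (forall r : R, 0 < r -> 0 <= w r) -> Phi phi.
Proof.
move=> cphi H w0; apply: radial_pd_Phi => //.
apply: radial_pd_shift_lim.
  by move=> e e0; exact: (heat_rep_radial_pd _ _ H).
by move=> s s0; exact: continuous_sqrt_shift.
Qed.

Lemma heat_rep_ge0_of_Phi (w phi : R -> R) : Phi phi ->
  heat_rep w (fun t => phi (Num.sqrt t)) ->
  (forall r : R, 0 < r -> {for r, continuous w}) ->
  forall r : R, 0 < r -> 0 <= w r.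
Proof.
move=> HP H cw; apply: (heat_rep_ge0 _ _ H) => //.
by apply: radial_pd_completely_monotone; exact: Phi_radial_pd.
Qed.

Let mDpos : @measurable _ (measurableTypeR R) Dpos.
Proof. exact: measurable_itv. Qed.

Lemma heat_repB (w1 w2 G1 G2 : R -> R) : heat_rep w1 G1 -> heat_rep w2 G2 ->
  heat_rep (fun r => w1 r - w2 r) (fun t => G1 t - G2 t).
Proof.
move=> H1 H2 t t0; have [i1 E1] := H1 t t0; have [i2 E2] := H2 t t0.
have E : (fun r => heat_ker (Num.sqrt t) r * (w1 r - w2 r)) =
   (fun r => heat_ker (Num.sqrt t) r * w1 r - heat_ker (Num.sqrt t) r * w2 r).
  by apply/funext => r; ring.
rewrite E; split.
  have := integrableB mDpos i1 i2.
  exact: eq_integrable.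
by rewrite RintegralB// E1 E2.
Qed.

Lemma heat_repZ (c : R) (w G : R -> R) : heat_rep w G ->
  heat_rep (fun r => c * w r) (fun t => c * G t).
Proof.
move=> H t t0; have [i1 E1] := H t t0.
have E : (fun r => heat_ker (Num.sqrt t) r * (c * w r)) =
   (fun r => c * (heat_ker (Num.sqrt t) r * w r)).
  by apply/funext => r; ring.
rewrite E; split.
  have := integrableZl mDpos c i1.
  exact: eq_integrable.
by rewrite RintegralZl// E1.
Qed.

Lemma heat_rep_eq (w G G' : R -> R) : (forall t : R, 0 < t -> G t = G' t) ->
  heat_rep w G -> heat_rep w G'.
Proof. by move=> E H t t0; rewrite -E//; exact: H. Qed.

Lemma heat_rep_of_integral (w G : R -> R) :
  (forall r : R, 0 < r -> 0 <= w r) ->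
  (forall r : R, 0 < r -> {for r, continuous w}) ->
  (forall x : R, 0 < x ->
    (\int[mu]_(r in `](0%R:R), +oo[) (heat_ker x r * w r)%:E = (G (x ^+
      2)%R)%:E)%E) ->
  heat_rep w G.
Proof.
move=> w0 cw H t t0.
have x0 : 0 < Num.sqrt t by rewrite sqrtr_gt0.
have E := H _ x0; rewrite sqr_sqrtr ?(ltW t0)// in E.
have m : measurable_fun Dpos (fun r => heat_ker (Num.sqrt t) r * w r).
  apply: open_continuous_measurable_fun => // r.
  rewrite inE/= in_itv/= andbT => r0.
  by apply: cvgM; [exact: heat_ker_continuous|exact: cw].
split; last by rewrite /Rintegral E.
apply/integrableP; split; first exact/measurable_EFinP.
rewrite (_ : (\int[_]_(_ in _) _)%E = (G t)%:E) ?ltry// -E.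
apply: eq_integral => r; rewrite inE/= in_itv/= andbT => r0.
by rewrite ger0_norm// mulr_ge0 ?heat_ker_ge0 ?w0.
Qed.

End Schoenberg.

(** * Iterated differences *)

Section IteratedDifferences.
Context {R : realType}.

Lemma iter_decr_scale (F : R -> R) (c h : R) n t :
  iter n (decr h) (fun t => F (c * t)) t = iter n (decr (c * h)) F (c * t).
Proof.
elim: n t => //= n IH t; rewrite /decr -/(decr h) -/(decr (c * h)) !IH.
by rewrite mulrDr.
Qed.

Lemma iter_decrB (F G : R -> R) (h : R) n t :
  iter n (decr h) (fun t => F t - G t) t = iter n (decr h) F t - iter n (decr h)
    G t.
Proof.
elim: n t => //= n IH t; rewrite /decr -/(decr h) !IH; ring.
Qed.

Lemma iter_decrN (F : R -> R) (h : R) n t :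
  iter n (decr h) (fun t => - F t) t = - iter n (decr h) F t.
Proof.
elim: n t => //= n IH t; rewrite /decr -/(decr h) !IH; ring.
Qed.

Lemma iter_decr_ext (F G : R -> R) (h : R) n t : 0 <= h -> 0 < t ->
  (forall t : R, 0 < t -> F t = G t) -> iter n (decr h) F t = iter n (decr h) G t.
Proof.
move=> h0 t0 FG; elim: n t t0 => [|n IH] t t0 /=; first exact: FG.
by rewrite /decr -/(decr h) !IH// ltr_wpDr.
Qed.

(** Differentiation in a parameter commutes with the differences in t. *)
Lemma is_derive_iter_decr (K K' : R -> R -> R) (rho h : R) n t : 0 <= h -> 0 < t ->
  (forall t : R, 0 < t -> is_derive rho 1 (fun rho => K rho t) (K' rho t)) ->
  is_derive rho 1 (fun rho => iter n (decr h) (K rho) t)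
    (iter n (decr h) (K' rho) t).
Proof.
move=> h0 t0 HK; elim: n t t0 => [|n IH] t t0 /=; first exact: HK.
rewrite {2}/decr -/(decr h).
rewrite (_ : (fun rho0 => _) = (fun rho =>
  iter n (decr h) (K rho) t - iter n (decr h) (K rho) (t + h)))//.
have := IH t t0; have := IH (t + h) (ltr_wpDr h0 t0) => d1 d2.
exact: is_deriveB.
Qed.

End IteratedDifferences.

(** * Continuity of g, h and the derivative of h *)

Section ExpLimits.
Context {R : realType}.

Lemma expRM_slope_cvg (c : R) : (expR (c * x) - 1) / x @[x --> 0^'+] --> c.
Proof.
have d : is_derive (0 : R) 1 (fun x => expR (c * x)) c.
  by apply: is_derive_eq; rewrite /= /GRing.scale/= mulr0 expR0; ring.
move/is_derive1_caratheodory : d => [k [kE kc k0]].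
rewrite -[X in _ --> X]k0.
have kr : k z @[z --> 0^'+] --> k 0 by exact: cvg_at_right_filter.
apply: cvg_trans kr; apply: near_eq_cvg; near=> x.
have x0 : 0 < x by near: x; exact: nbhs_right_gt.
have := kE x; rewrite mulr0 expR0 subr0 => ->.
by rewrite mulfK// gt_eqF.
Unshelve. all: by end_near. Qed.

(** The second order term of exp at 0 is what determines g(0) and h'(0). *)
Lemma expR_second_order_cvg :
  (expR x - 1 - x) / x ^+ 2 @[x --> (0:R)^'+] --> (2^-1 : R).
Proof.
have up : expR x / 2 @[x --> (0:R)^'+] --> (2^-1 : R).
  rewrite -[X in _ --> X]mul1r -[X in X / 2]expR0; apply: cvgM; last exact: cvg_cst.
  by apply: cvg_at_right_filter; exact: continuous_expR.
have lo : (cst (2^-1 : R)) x @[x --> (0:R)^'+] --> (2^-1 : R) by exact: cvg_cst.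
apply: (squeeze_cvgr _ lo up); near=> x; rewrite /cst.
have x0 : 0 < x by near: x; exact: nbhs_right_gt.
have x2 : 0 < x ^+ 2 by rewrite exprn_gt0.
rewrite ler_pdivlMr// ler_pdivrMr//; apply/andP; split.
- have : expR 0 - 1 - 0 - 2^-1 * 0 ^+ 2 <= expR x - 1 - x - 2^-1 * x ^+ 2.
    apply: (@ge0_derive_le _ (fun x => expR x - 1 - x - 2^-1 * x ^+ 2)
      (fun x => expR x - 1 - x)); first exact: ltW.
      by move=> y _; apply: is_derive_eq; rewrite /= /GRing.scale/=; field.
    by move=> y _; have := expR_ge1Dx y; lra.
  by rewrite expR0 expr0n /=; lra.
- have : (1 + 0) * expR (- 0) - 1 + 2^-1 * 0 ^+ 2 <= (1 + x) * expR (- x) - 1 +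
    2^-1 * x ^+ 2.
    apply: (@ge0_derive_le _ (fun x => (1 + x) * expR (- x) - 1 + 2^-1 * x ^+ 2)
      (fun x => x * (1 - expR (- x)))); first exact: ltW.
      by move=> y _; apply: is_derive_eq; rewrite /= /GRing.scale/=; field.
    move=> y /andP[y0 _]; rewrite mulr_ge0// subr_ge0 expR_le1; lra.
  rewrite oppr0 expR0 expr0n /= => H.
  have e1 : expR x * expR (- x) = 1 by exact: expRxMexpNx_1.
  have := expR_gt0 x; nra.
Unshelve. all: by end_near. Qed.

Lemma expR_slope1_cvg : (expR x - 1) / x @[x --> (0:R)^'+] --> (1 : R).
Proof. by have := expRM_slope_cvg 1; under eq_fun do rewrite mul1r. Qed.

Variable u : R.
Hypothesis u0 : 0 <= u.

(** The sum of the exp(- a_k x), by geo_cvg. *)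
Definition geo (x : R) : R := expR (- u * x) / (expR x - 1).

Lemma geo_cvg (x : R) : 0 < x ->
  series (fun k => expR (- (node u k) * x)) @ \oo --> geo x.
Proof.
move=> x0.
have z1 : expR (- x) < 1 by rewrite expR_lt1 oppr_lt0.
have := @cvg_geometric_series R (expR (- (u + 1) * x)) (expR (- x)).
rewrite ger0_norm ?expR_ge0// => /(_ z1).
rewrite (_ : series (geometric _ _) = series (fun k =>
  expR (- (node u k) * x))); last first.
  congr series; apply/funext => k; rewrite /geometric/= -expRM_natl -expRD.
  by congr expR; rewrite /node -natr1; ring.
have e1 : expR x - 1 != 0 by rewrite gt_eqF// subr_gt0 pexpR_gt1.
have -> : expR (- (u + 1) * x) * (1 - expR (- x))^-1 = geo x; last by [].
have -> : - (u + 1) * x = - u * x + - x by ring.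
rewrite /geo expRD expRN; field.
by rewrite e1 gt_eqF// expR_gt0.
Qed.

Lemma geo_continuous (x : R) : 0 < x -> {for x, continuous geo}.
Proof.
move=> x0; apply: cvgM.
  apply: continuous_comp; last exact: continuous_expR.
  by apply: cvgM; [exact: cvg_cst|exact: cvg_id].
apply: cvgV; first by rewrite gt_eqF// subr_gt0 pexpR_gt1.
by apply: cvgB; [exact: continuous_expR|exact: cvg_cst].
Qed.

Lemma h_geo (x : R) : 0 < x -> h u x = x * geo x.
Proof. by move=> x0; rewrite /h x0 /geo; ring. Qed.

Lemma g_geo (p x : R) : 0 < x -> g p u x = expR (- p * x) / x - geo x.
Proof. by move=> x0; rewrite /g x0. Qed.

Lemma h_slope_cvg : (h u x - 1) / x @[x --> 0^'+] --> - (u + 2^-1).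
Proof.
have c : ((expR (- u * x) - 1) / x - (expR x - 1 - x) / x ^+ 2) / ((expR x - 1) / x)
   @[x --> 0^'+] --> (- u - 2^-1) / 1.
  apply: cvgM.
    by apply: cvgB; [exact: expRM_slope_cvg|exact: expR_second_order_cvg].
  by apply: cvgV; [exact: oner_neq0|exact: expR_slope1_cvg].
rewrite divr1 -opprD in c; apply: cvg_trans c; apply: near_eq_cvg; near=> x.
have x0 : 0 < x by near: x; exact: nbhs_right_gt.
rewrite h_geo// /geo.
have e1 : expR x - 1 != 0 by rewrite gt_eqF// subr_gt0 pexpR_gt1.
by field; rewrite e1 gt_eqF.
Unshelve. all: by end_near. Qed.

Lemma g_continuous (p : R) : {within `[0, +oo[, continuous (g p u)}.
Proof.
apply/continuous_within_itvcyP; split.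
- move=> x; rewrite in_itv/= andbT => x0.
  rewrite /continuous_at g_geo//.
  have c : expR (- p * z) / z - geo z @[z --> x] --> expR (- p * x) / x - geo x.
    apply: cvgB; last exact: geo_continuous.
    apply: cvgM; last by apply: cvgV; [rewrite gt_eqF|exact: cvg_id].
    apply: continuous_cvg; first exact: continuous_expR.
    by apply: cvgM; [exact: cvg_cst|exact: cvg_id].
  apply: cvg_trans c; apply: near_eq_cvg; near=> z.
  by rewrite g_geo//; near: z; exact: lt_nbhsr.
- have c : (expR (- p * x) - 1) / x - (h u x - 1) / x @[x --> 0^'+] --> - p - -
    (u + 2^-1).
    by apply: cvgB; [exact: expRM_slope_cvg|exact: h_slope_cvg].
  rewrite {2}/g ltxx.
  rewrite (_ : - p - - (u + 2^-1) = u + 2^-1 - p) in c; last by ring.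
  apply: cvg_trans c; apply: near_eq_cvg; near=> x.
  have x0 : 0 < x by near: x; exact: nbhs_right_gt.
  by rewrite g_geo// h_geo//; field; rewrite gt_eqF.
Unshelve. all: by end_near. Qed.

Definition dh (x : R) : R :=
  expR (- u * x) * ((1 - u * x) * (expR x - 1) - x * expR x) / (expR x - 1) ^+ 2.

Lemma is_derive_h (x : R) : 0 < x -> is_derive x 1 (h u) (dh x).
Proof.
move=> x0.
have e1 : expR x - 1 != 0 by rewrite gt_eqF// subr_gt0 pexpR_gt1.
have d1 : is_derive x 1 (fun x => expR x - 1) (expR x).
  by apply: is_derive_eq; rewrite subr0.
have d2 := @is_deriveV R (fun x => expR x - 1) x (expR x) 1 e1 d1.
have d3 : is_derive x 1 (fun x =>
  x * expR (- u * x)) (expR (- u * x) * (1 - u * x)).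
  by apply: is_derive_eq; rewrite /= /GRing.scale/=; ring.
have d4 : is_derive x 1 (fun x => x * expR (- u * x) * (expR x - 1)^-1) (dh x).
  apply: is_derive_eq; rewrite /= /GRing.scale/= /dh.
  by field.
apply: (near_eq_is_derive _ d4); near=> z.
have z0 : 0 < z by near: z; exact: lt_nbhsr.
by rewrite /h z0; ring.
Unshelve. all: by end_near. Qed.

Lemma dh_continuous (x : R) : 0 < x -> {for x, continuous dh}.
Proof.
move=> x0.
have e1 : expR x - 1 != 0 by rewrite gt_eqF// subr_gt0 pexpR_gt1.
have ce : expR z @[z --> x] --> expR x by exact: continuous_expR.
have cu : u * z @[z --> x] --> u * x by apply: cvgM; [exact: cvg_cst|exact: cvg_id].
have c1 : expR z - 1 @[z --> x] --> expR x - 1 by apply: cvgB => //; exact: cvg_cst.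
apply: cvgM; first (apply: cvgM; last (apply: cvgB; apply: cvgM => //)).
- apply: continuous_cvg; first exact: continuous_expR.
  by apply: cvgM; [exact: cvg_cst|exact: cvg_id].
- by apply: cvgB => //; exact: cvg_cst.
- apply: cvgV; first by rewrite sqrf_eq0.
  rewrite (_ : (fun z => _) = (fun z => (expR z - 1) * (expR z - 1))); last first.
    by apply/funext => z; rewrite expr2.
  by rewrite expr2; exact: cvgM.
Qed.

Lemma dh_cvg0 : - dh x @[x --> 0^'+] --> u + 2^-1.
Proof.
have c : - (expR (- u * x) * ((expR x - 1 - x) / x ^+ 2 - (expR x - 1) / x - u *
  ((expR x - 1) / x))
     / (((expR x - 1) / x) * ((expR x - 1) / x)))
   @[x --> 0^'+] --> - (expR (- u * 0) * (2^-1 - 1 - u * 1) / (1 * 1)).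
  apply: cvgN; apply: cvgM.
    apply: cvgM.
      apply: cvg_at_right_filter.
      apply: continuous_cvg; first exact: continuous_expR.
      by apply: cvgM; [exact: cvg_cst|exact: cvg_id].
    apply: cvgB; first by apply: cvgB;
      [exact: expR_second_order_cvg|exact: expR_slope1_cvg].
    by apply: cvgM; [exact: cvg_cst|exact: expR_slope1_cvg].
  by apply: cvgV; [rewrite mulr1 oner_neq0|apply: cvgM; exact: expR_slope1_cvg].
rewrite (_ : - (_ * _ / _) = u + 2^-1) in c; last by rewrite mulr0 expR0; field.
apply: cvg_trans c; apply: near_eq_cvg; near=> x.
have x0 : 0 < x by near: x; exact: nbhs_right_gt.
have e1 : expR x - 1 != 0 by rewrite gt_eqF// subr_gt0 pexpR_gt1.
by rewrite /dh; field; rewrite e1 gt_eqF.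
Unshelve. all: by end_near. Qed.

Lemma derive_halfline_h (x : R) : 0 < x -> derive_halfline (h u) x = dh x.
Proof.
move=> x0; rewrite /derive_halfline x0 derive1E.
by have [_ ->] := is_derive_h x x0.
Qed.

Lemma derive_halfline_h0 : derive_halfline (h u) 0 = - (u + 2^-1).
Proof.
rewrite /derive_halfline ltxx; apply: cvg_lim => //.
have h0 : h u 0 = 1 by rewrite /h ltxx.
rewrite h0; have := h_slope_cvg.
by under eq_fun do rewrite mulrC.
Qed.

Lemma derive_h_continuous :
  {within `[0, +oo[, continuous (fun x => - derive_halfline (h u) x)}.
Proof.
apply/continuous_within_itvcyP; split.
- move=> x; rewrite in_itv/= andbT => x0.
  rewrite /continuous_at derive_halfline_h//.
  have c : - dh z @[z --> x] --> - dh x by apply: cvgN; exact: dh_continuous.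
  apply: cvg_trans c; apply: near_eq_cvg; near=> z.
  by rewrite derive_halfline_h//; near: z; exact: lt_nbhsr.
- rewrite derive_halfline_h0 opprK.
  apply: cvg_trans dh_cvg0; apply: near_eq_cvg; near=> x.
  by rewrite derive_halfline_h//; near: x; exact: nbhs_right_gt.
Unshelve. all: by end_near. Qed.

End ExpLimits.

(** * The three equivalences *)

Section Representations.
Context {R : realType}.
Notation mu := (@lebesgue_measure R).

Variable u : R.
Hypothesis u0 : 0 <= u.

(** The second representation is the sum over k of the second integral of
    heat_ker_integrals at a = a_k q, since q^2 r^2 a_k^2 = (a_k q)^2 r^2; terms
    are nonnegative, so summation and integration commute. *)
Lemma kernel_representations : exists2 C : R, 0 < C &
  (forall p : R, 0 <= p ->
    heat_rep (fun r => expR (- (p ^+ 2 * r ^+ 2)))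
      (fun t => C * (expR (- p * Num.sqrt t) / Num.sqrt t))) /\
  (forall q : R, 0 < q ->
    heat_rep (fun r => theta u (q ^+ 2 * r ^+ 2))
      (fun t => C * (q * geo u (q * Num.sqrt t)))).
Proof.
have [C C0 H] := @heat_ker_integrals R.
have sq_pos (q r : R) : 0 < q -> 0 < r -> 0 < q ^+ 2 * r ^+ 2.
  by move=> q0 r0; rewrite mulr_gt0// exprn_gt0.
have cont_sq (q r : R) : {for r, continuous (fun r : R => q ^+ 2 * r ^+ 2)}.
  by apply: cvgM; [exact: cvg_cst|exact: exprn_continuous].
exists C => //; split=> [p p0|q q0].
  apply: heat_rep_of_integral.
  - by move=> r r0; exact: expR_ge0.
  - by move=> r r0; exact: expsq_continuous.
  - by move=> x x0; rewrite (proj1 (H x x0))// sqrtr_sqr gtr0_norm.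
apply: heat_rep_of_integral.
- by move=> r r0; apply: theta_ge0 => //; exact: sq_pos.
- move=> r r0; apply: (@continuous_comp _ _ _ (fun r : R =>
    q ^+ 2 * r ^+ 2) (theta u)).
    exact: cont_sq.
  by apply: theta_continuous => //; exact: sq_pos.
move=> x x0; rewrite sqrtr_sqr (gtr0_norm x0).
have qx : 0 < q * x by rewrite mulr_gt0.
have cG := geo_cvg u (q * x) qx.
have cI := series_cvgZ _ (C * q) (cvgP _ cG).
rewrite (cvg_lim _ cG)// in cI.
rewrite mulrA -(cvg_lim _ cI)//.
pose f (k : nat) (r : R) := heat_ker x r * theta_term u (q ^+ 2 * r ^+ 2) k.
transitivity (\int[mu]_(r in `](0%R:R), +oo[) (limn (series (f^~ r)))%:E)%E.
  apply: eq_integral => r; rewrite inE/= in_itv/= andbT => r0; congr EFin.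
  apply/esym; apply: cvg_lim => //.
  by apply: series_cvgZ; apply: theta_cvg => //; exact: sq_pos.
apply: integral_series.
- exact: measurable_itv.
- move=> k; apply: open_continuous_measurable_fun => // r.
  rewrite inE/= in_itv/= andbT => r0.
  apply: cvgM; first exact: heat_ker_continuous.
  apply: cvgM; first by apply: cvgM; [exact: cvg_cst|exact: cont_sq].
  apply: continuous_cvg; first exact: continuous_expR.
  by apply: cvgN; apply: cvgM; [exact: cvg_cst|exact: cont_sq].
- move=> k r; rewrite /= in_itv/= andbT => r0.
  by rewrite mulr_ge0 ?heat_ker_ge0// theta_term_ge0// ltW// sq_pos.
- move=> r; rewrite /= in_itv/= andbT => r0.
  by apply: cvgP; apply: series_cvgZ; apply: theta_cvg => //; exact: sq_pos.
- move=> k.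
  have aq : 0 < node u k * q by rewrite mulr_gt0// node_gt0.
  have E := proj2 (H x x0) _ aq.
  transitivity (\int[mu]_(r in `](0%R:R), +oo[)
     (q%:E * (heat_ker x r * (2 * (node u k * q) * r ^+ 2 * expR (- ((node u k *
       q) ^+ 2 * r ^+ 2))))%:E))%E.
    apply: eq_integral => r _; rewrite -EFinM; congr EFin; rewrite /f /theta_term.
    have -> : node u k ^+ 2 * (q ^+ 2 * r ^+ 2) = (node u k * q) ^+ 2 * r ^+ 2 by
      ring.
    by ring.
  rewrite ge0_integralZl_EFin//.
  + rewrite E -EFinM; congr EFin.
    have -> : - (node u k * q) * x = - node u k * (q * x) by ring.
    by ring.
  + move=> r _; rewrite lee_fin; apply: mulr_ge0; first exact: heat_ker_ge0.
    apply: mulr_ge0; last exact: expR_ge0.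
    apply: mulr_ge0; last exact: sqr_ge0.
    by rewrite mulr_ge0// ltW.
  + apply/measurable_EFinP; apply: open_continuous_measurable_fun => // r.
    rewrite inE/= in_itv/= andbT => r0.
    apply: cvgM; first exact: heat_ker_continuous.
    apply: cvgM; last exact: expsq_continuous.
    by apply: cvgM; [exact: cvg_cst|exact: exprn_continuous].
  + exact: ltW.
- exact: cvgP cI.
Qed.

Lemma g_representation (p : R) : 0 <= p -> exists2 C : R, 0 < C &
  heat_rep (fun r => C * (expR (- (p ^+ 2 * r ^+ 2)) - theta u (r ^+ 2)))
    (fun t => g p u (Num.sqrt t)).
Proof.
move=> p0; have [C C0 [H1 H2]] := kernel_representations.
exists C^-1; first by rewrite invr_gt0.
have := heat_repZ C^-1 _ _ (heat_repB _ _ _ _ (H1 p p0) (H2 1 ltr01)).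
rewrite (_ : (fun r => _) = (fun r =>
  C^-1 * (expR (- (p ^+ 2 * r ^+ 2)) - theta u (r ^+ 2)))).
  apply: heat_rep_eq => t t0.
  rewrite g_geo ?sqrtr_gt0// !mul1r -mulrBr mulrA mulVf ?mul1r// gt_eqF//.
by apply/funext => r; rewrite expr1n mul1r.
Qed.

(** Dilating x by q dilates the weight.  This replaces a representation of h'
    itself, whose weight would involve the derivative of theta. *)
Lemma h_dilation_representation : exists2 C : R, 0 < C & forall q : R, 0 < q ->
  heat_rep (fun r => C * (theta u (q ^+ 2 * r ^+ 2) - theta u (r ^+ 2)))
    (fun t => h u (q * Num.sqrt t) / Num.sqrt t - h u (Num.sqrt t) / Num.sqrt t).
Proof.
have [C C0 [_ H2]] := kernel_representations.
exists C^-1; first by rewrite invr_gt0.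
move=> q q0.
have := heat_repZ C^-1 _ _ (heat_repB _ _ _ _ (H2 q q0) (H2 1 ltr01)).
rewrite (_ : (fun r => _) = (fun r =>
  C^-1 * (theta u (q ^+ 2 * r ^+ 2) - theta u (r ^+ 2)))).
  apply: heat_rep_eq => t t0.
  have x0 : 0 < Num.sqrt t by rewrite sqrtr_gt0.
  rewrite !h_geo ?mulr_gt0// !mul1r.
  by field; rewrite !gt_eqF.
by apply/funext => r; rewrite expr1n mul1r.
Qed.

Lemma theta_sq_continuous (q r : R) : 0 < q -> 0 < r ->
  {for r, continuous (fun r : R => theta u (q ^+ 2 * r ^+ 2))}.
Proof.
move=> q0 r0; apply: (@continuous_comp _ _ _ (fun r : R =>
  q ^+ 2 * r ^+ 2) (theta u)).
  by apply: cvgM; [exact: cvg_cst|exact: exprn_continuous].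
by apply: theta_continuous => //; rewrite mulr_gt0// exprn_gt0.
Qed.

Lemma theta_sq1_continuous (r : R) : 0 < r ->
  {for r, continuous (fun r : R => theta u (r ^+ 2))}.
Proof.
move=> r0; apply: (@continuous_comp _ _ _ (fun r : R => r ^+ 2) (theta u)).
  exact: exprn_continuous.
by apply: theta_continuous => //; rewrite exprn_gt0.
Qed.

Lemma Phi_ge0 (phi : R -> R) x : Phi phi -> 0 < x -> 0 <= phi x.
Proof.
move=> /Phi_radial_pd H x0.
have x2 : 0 < x ^+ 2 by rewrite exprn_gt0.
by have := radial_pd_ge0 _ _ H x2; rewrite sqrtr_sqr gtr0_norm.
Qed.

(** The first difference is nonnegative. *)
Lemma Phi_noninc (phi : R -> R) x y : Phi phi -> 0 < x -> x < y -> phi y <= phi x.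
Proof.
move=> /Phi_radial_pd/radial_pd_completely_monotone H x0 xy.
have y0 := lt_trans x0 xy.
have x2 : 0 < x ^+ 2 by rewrite exprn_gt0.
have h0 : 0 < y ^+ 2 - x ^+ 2 by rewrite subr_gt0 ltr_sqr ?nnegrE// ltW.
have := H 1 _ _ x2 h0; rewrite /= /decr [x ^+ 2 + _]addrC subrK.
by rewrite !sqrtr_sqr !gtr0_norm// subr_ge0.
Qed.

(** For p < 0 the function g is unbounded at infinity, but a function in Phi is
    nonincreasing. *)
Lemma Phi_g_p_ge0 (p : R) : Phi (g p u) -> 0 <= p.
Proof.
move=> H; rewrite leNgt; apply/negP => p0.
have p2 : 0 < p ^+ 2 by rewrite exprn_even_gt0//= lt_eqF.
have g1 : 0 <= g p u 1 by exact: Phi_ge0.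
(* At this x the lower bound p^2 x / 2 - 1 for g p u x exceeds g p u 1. *)
pose x : R := 2 + 2 * (g p u 1 + 1) / p ^+ 2.
have x2 : 2 <= x by rewrite lerDl divr_ge0 ?(ltW p2)// mulr_ge0// addr_ge0.
have x0 : 0 < x by lra.
have := Phi_noninc _ 1 x H ltr01 (lt_le_trans (ltr1n R 2) x2).
rewrite [X in X <= _ -> _]g_geo// => gx.
have b1 : geo u x <= 1.
  have ex : 1 <= expR x - 1 by have := expR_ge1Dx x; lra.
  have e0 : 0 < expR x - 1 by lra.
  rewrite /geo ler_pdivrMr// mul1r; apply: le_trans ex.
  by rewrite expR_le1 mulNr oppr_le0 mulr_ge0// ltW.
have px : 0 <= - p * x by rewrite mulr_ge0 ?oppr_ge0// ltW.
have e2 := expR_ge1Dxn 1 px.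
have e3 : p ^+ 2 * x / 2 <= expR (- p * x) / x.
  rewrite ler_pdivlMr//; apply: le_trans e2.
  rewrite exprMn sqrrN (_ : 2`!%:R = 2 :> R)//.
  rewrite (_ : p ^+ 2 * x / 2 * x = p ^+ 2 * x ^+ 2 / 2); last by field.
  by rewrite lerDr.
have e4 : p ^+ 2 * x = 2 * p ^+ 2 + 2 * (g p u 1 + 1).
  by rewrite /x; field; rewrite lt_eqF.
move: e3; rewrite e4 => e3.
by move: gx b1 e3; lra.
Qed.

Lemma theta_le_sq (c : R) : (forall r : R, 0 < r ->
  theta u (r ^+ 2) <= expR (- (c * r ^+ 2))) ->
  forall s : R, 0 < s -> theta u s <= expR (- (c * s)).
Proof.
move=> H s s0; have r0 : 0 < Num.sqrt s by rewrite sqrtr_gt0.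
by have := H _ r0; rewrite sqr_sqrtr// ltW.
Qed.

Lemma Phi_gP (p : R) : Phi (g p u) <-> 0 <= p /\ (p%:E <= sqrte (m_infty u))%E.
Proof.
split=> [H|[p0 pm]].
  have p0 := Phi_g_p_ge0 p H; split=> //.
  apply/le_sqrt_m_infty => //; apply: theta_le_sq => r r0.
  have [C C0 HC] := g_representation p p0.
  have := heat_rep_ge0_of_Phi _ _ H HC; rewrite -subr_ge0 -(pmulr_rge0 _ C0).
  apply=> // z z0; apply: cvgM; first exact: cvg_cst.
  apply: cvgB; last exact: theta_sq1_continuous.
  exact: expsq_continuous.
have [C C0 HC] := g_representation p p0.
apply: (Phi_of_heat_rep _ _ _ HC); first exact: g_continuous.
move=> r r0; rewrite pmulr_rge0// subr_ge0.
by move/(le_sqrt_m_infty u u0 p p0) : pm; apply; rewrite exprn_gt0.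
Qed.

(** Nonnegativity of - g alone gives exp((u + 1 - p) x) <= 2 x for large x. *)
Lemma Phi_Ng_p_ge (p : R) : Phi (fun x => - g p u x) -> u + 1 <= p.
Proof.
move=> H; rewrite leNgt; apply/negP => pu.
have [d dE] : exists d, d = u + 1 - p by exists (u + 1 - p).
have d0 : 0 < d by rewrite dE subr_gt0.
(* At this x the bound exp (d x) >= (d x)^2 / 2 exceeds 2 x. *)
pose x : R := 1 + 4 / d ^+ 2.
have d2 : 0 < d ^+ 2 by rewrite exprn_gt0.
have x1 : 1 <= x by rewrite lerDl divr_ge0// ltW.
have x0 : 0 < x by lra.
have := Phi_ge0 _ x H x0; rewrite g_geo// opprB subr_ge0 /geo.
have ex : 2 <= expR x by have := expR_ge1Dx x; lra.
have e0 : 0 < expR x - 1 by lra.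
rewrite ler_pdivlMr// mulrAC ler_pdivrMr// => h1.
have h2 : expR (- p * x) * expR x <= 2 * (expR (- u * x) * x).
  have := expR_gt0 (- p * x); nra.
have h3 : expR (d * x) <= 2 * x.
  have := ler_wpM2l (expR_ge0 (u * x)) h2.
  rewrite -expRD -expRD [leRHS](_ : _ = 2 * x * (expR (u * x) * expR (- u * x)));
    last by ring.
  rewrite -expRD (_ : u * x + - u * x = 0); last by ring.
  rewrite expR0 mulr1; congr (expR _ <= _); rewrite dE; ring.
have dx : 0 <= d * x by rewrite mulr_ge0// ltW.
have h4 := expR_ge1Dxn 1 dx.
have h5 : d ^+ 2 * x / 2 * x <= 2 * x.
  apply: le_trans h3; apply: le_trans h4.
  rewrite exprMn (_ : 2`!%:R = 2 :> R)//.
  rewrite (_ : d ^+ 2 * x / 2 * x = d ^+ 2 * x ^+ 2 / 2); last by field.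
  by rewrite lerDr.
have h6 : d ^+ 2 * x = d ^+ 2 + 4 by rewrite /x; field; rewrite gt_eqF.
by move: h5; rewrite ler_pM2r// h6; lra.
Qed.

Lemma Phi_NgP (p : R) : Phi (fun x => - g p u x) <-> u + 1 <= p.
Proof.
split=> [|pu]; first exact: Phi_Ng_p_ge.
have u1 : 0 <= u + 1 by rewrite addr_ge0.
have p0 := le_trans u1 pu.
have [C C0 HC] := g_representation p p0.
apply: (Phi_of_heat_rep _ _ _ (heat_rep_eq _ _ _ _ (heat_repZ (-1) _ _ HC))).
- move=> x; apply: continuousN; exact: g_continuous.
- by move=> t t0; rewrite mulN1r.
- move=> r r0; rewrite mulN1r -mulrN opprB pmulr_rge0// subr_ge0.
  have r2 : 0 < r ^+ 2 by rewrite exprn_gt0.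
  apply: le_trans (theta_ge u u0 _ r2).
  rewrite ler_expR lerN2; apply: ler_wpM2r; first exact: ltW.
  by rewrite ler_sqr ?nnegrE.
Qed.

(** If - h' is in Phi, the differences of the quotient (h(q x) - h(x)) / x as
    a function of t = x^2 are nonnegative: for a fixed t, the n-th difference of
    h(rho sqrt t) / sqrt t is nonincreasing in rho, since its derivative in rho is
    that of h'(rho sqrt t), and a dilation turns it into a difference of another
    step.  Then heat_rep_ge0 gives theta(s) >= theta(s') for s = q^2 s'.
    Conversely, if theta is nonincreasing, the quotients are positive definite
    and tend to - h' after division by 1 - q. *)
Lemma Phi_derive_hP : Phi (fun x => - derive_halfline (h u) x) <->
  (forall s s' : R, 0 < s -> s <= s' -> theta u s' <= theta u s).
Proof.
have [C C0 HC] := h_dilation_representation.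
split=> [H|H].
- have cm : completely_monotone (fun t => - derive_halfline (h u) (Num.sqrt t)).
    by apply: radial_pd_completely_monotone;
      exact: (Phi_radial_pd (fun x => - derive_halfline (h u) x)).
  have cmq (q : R) : 0 < q -> q < 1 -> completely_monotone
     (fun t => h u (q * Num.sqrt t) / Num.sqrt t - h u (Num.sqrt t) / Num.sqrt t).
    move=> q0 q1 n t k t0 k0.
    pose K (rho t : R) := h u (rho * Num.sqrt t) / Num.sqrt t.
    have E1 : (fun t => h u (Num.sqrt t) / Num.sqrt t) = K 1.
      by apply/funext => z; rewrite /K mul1r.
    rewrite (iter_decrB (K q) (fun t => h u (Num.sqrt t) / Num.sqrt t)) E1 subr_ge0.
    rewrite -lerN2.
    apply: (@ge0_derive_le _ (fun rho => - iter n (decr k) (K rho) t)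
      (fun rho => - iter n (decr k) (fun t => dh u (rho * Num.sqrt t)) t)).
    + exact: ltW.
    + move=> rho /andP[qr _]; have r0 := lt_le_trans q0 qr.
      apply: is_deriveN.
      apply: (@is_derive_iter_decr _ K (fun rho t =>
        dh u (rho * Num.sqrt t))) => //.
        exact: ltW.
      move=> z z0; have x0 : 0 < Num.sqrt z by rewrite sqrtr_gt0.
      have rx : 0 < rho * Num.sqrt z by rewrite mulr_gt0.
      have d1 := is_derive_h u _ rx.
      have d2 : is_derive rho 1 (fun rho => rho * Num.sqrt z) (Num.sqrt z).
        by apply: is_derive_eq; rewrite /= /GRing.scale/=; ring.
      have d3 : is_derive rho 1 (fun rho => h u (rho * Num.sqrt z))
          (dh u (rho * Num.sqrt z) * Num.sqrt z).
        exact: (@is_derive1_comp _ (h u) (fun rho => rho * Num.sqrt z)).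
      rewrite /K; apply: is_derive_eq; rewrite /= /GRing.scale/=.
      by field; rewrite gt_eqF.
    + move=> rho /andP[qr _]; have r0 := lt_le_trans q0 qr.
      rewrite -iter_decrN.
      pose F (t : R) := - derive_halfline (h u) (Num.sqrt t).
      rewrite (@iter_decr_ext _ _ (fun t => F (rho ^+ 2 * t)))//; last 2 first.
      * exact: ltW.
      * move=> z z0; rewrite /F sqrtrM ?sqr_ge0// sqrtr_sqr gtr0_norm//.
        by rewrite derive_halfline_h// mulr_gt0// sqrtr_gt0.
      by rewrite iter_decr_scale; apply: cm; rewrite mulr_gt0// exprn_gt0.
  move=> s s' s0; rewrite le_eqVlt => /predU1P[->//|ss'].
  have s'0 := lt_trans s0 ss'.
  pose q := Num.sqrt (s / s').
  have q0 : 0 < q by rewrite sqrtr_gt0 divr_gt0.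
  have q1 : q < 1 by rewrite -sqrtr1 ltr_sqrt// ltr_pdivrMr// mul1r.
  have r0 : 0 < Num.sqrt s' by rewrite sqrtr_gt0.
  have cw (z : R) : 0 < z ->
      {for z, continuous (fun r : R => C *
        (theta u (q ^+ 2 * r ^+ 2) - theta u (r ^+ 2)))}.
    move=> z0; apply: cvgM; first exact: cvg_cst.
    have c1 := theta_sq_continuous q z q0 z0.
    have c2 := theta_sq1_continuous z z0.
    by apply: cvgB; [exact: c1|exact: c2].
  have := heat_rep_ge0 _ _ (HC q q0) (cmq q q0 q1) cw _ r0.
  rewrite pmulr_rge0// subr_ge0.
  rewrite (_ : q ^+ 2 * Num.sqrt s' ^+ 2 = s).
    by rewrite sqr_sqrtr// ltW.
  by rewrite /q !sqr_sqrtr ?(ltW s'0)// ?divfK ?gt_eqF// divr_ge0// ltW.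
- apply: radial_pd_Phi; first exact: derive_h_continuous.
  apply: radial_pd_shift_lim; last first.
    move=> s s0.
    exact: (continuous_sqrt_shift (fun x =>
      - derive_halfline (h u) x) _ (derive_h_continuous u)).
  move=> e e0 I J x J0.
  pose G (q t : R) := h u (q * Num.sqrt t) / Num.sqrt t - h u (Num.sqrt t) /
    Num.sqrt t.
  apply: (@psd_cvg _ R (1^'-) _ I
    (fun q i j => (1 - q)^-1 * G q (sqdist I J x i j + e))).
    near=> q; have q1 : q < 1 by near: q; exact: nbhs_left_lt.
    have q0 : 0 < q by near: q; exact: nbhs_left_gt.
    have P := @heat_rep_radial_pd _ _ _ (HC q q0) _ e e0 I J x J0.
    move=> c.
    have -> : \sum_i \sum_j c i * c j * ((1 - q)^-1 * G q (sqdist I J x i j + e)) =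
       (1 - q)^-1 * \sum_i \sum_j c i * c j * G q (sqdist I J x i j + e).
      rewrite mulr_sumr; apply: eq_bigr => i _; rewrite mulr_sumr;
        apply: eq_bigr => j _.
      by ring.
    apply: mulr_ge0; first by rewrite invr_ge0 subr_ge0 ltW.
    apply: P => r r0; rewrite pmulr_rge0// subr_ge0.
    have r2 : 0 < r ^+ 2 by rewrite exprn_gt0.
    apply: H; first by rewrite mulr_gt0// exprn_gt0.
    by rewrite ler_piMl ?(ltW r2)// expr_le1 ?ltW.
  move=> i j; set t := _ + e.
  have t0 : 0 < t by rewrite /t ltr_wpDl// sqdist_ge0.
  have y0 : 0 < Num.sqrt t by rewrite sqrtr_gt0.
  rewrite derive_halfline_h//.
  have := is_derive_h u _ y0 => /is_derive1_caratheodory[k [kE kc k1]].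
  rewrite -k1.
  have c : - k (q * Num.sqrt t) @[q --> 1^'-] --> - k (Num.sqrt t).
    apply: cvgN; apply: continuous_cvg; first exact: kc.
    apply: cvg_at_left_filter; rewrite -[X in _ --> X]mul1r.
    by apply: cvgM; [exact: cvg_id|exact: cvg_cst].
  apply: cvg_trans c; apply: near_eq_cvg; near=> q.
  have q1 : q < 1 by near: q; exact: nbhs_left_lt.
  rewrite /G -mulrBl kE.
  by field; rewrite !gt_eqF// subr_gt0.
Unshelve. all: by end_near. Qed.

End Representations.

Theorem theorem2p11 (R : realType) (u : R) (hu : 0 <= u) :
  [/\ forall p : R,
        Phi (g p u) <-> 0 <= p /\ (p%:E <= sqrte (m_infty u))%E,
      sqrte (M_infty u) = (u + 1)%:E /\
      (forall p : R,
        Phi (fun x => - g p u x) <-> (sqrte (M_infty u) <= p%:E)%E) &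
      (forall mu t : R, 0 < mu -> 0 < t ->
        0 <= derive1 (fun s : R => s `^ (2 * mu) * S_mu mu s u) t) <->
      Phi (fun x => - derive_halfline (h u) x)].
Proof.
split.
- by move=> p; exact: Phi_gP.
- have E := sqrt_M_inftyE u hu; split=> // p.
  by rewrite E lee_fin; exact: Phi_NgP.
- apply: (iff_trans (derive_S_ge0P u hu)); apply: iff_sym.
  exact: Phi_derive_hP.
Qed.
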